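(* There is an absolute constant integer $c>0$ such that the following holds. For all integers $m\ge n\ge 1$ and all distributions $F_B,F_S$ on $\mathbb{R}$ such that $F_B$ first-order stochastically dominates $F_S$, the expected gains from trade of the Seller Trade Reduction (STR) mechanism run on $m+c$ buyers with values i.i.d. from $F_B$ and $n+c$ sellers with values i.i.d. from $F_S$ is at least the expected first-best gains from trade with $m$ buyers with values i.i.d. from $F_B$ and $n$ sellers with values i.i.d. from $F_S$. That is, $\mathrm{STR}(m+c,n+c)\ge \mathrm{OPT}(m,n)$.
   Context: Double auction: there are unit-demand buyers, each with private value drawn i.i.d. from $F_B$, and unit-supply sellers (each holding one identical item), each with private value (cost) drawn i.i.d. from $F_S$; all values are independent. For quantile $q\in(0,1)$ let $b(q)=\inf\{x:\Pr_{b\sim F_B}[b\le x]\ge q\}$ and $s(q)=\inf\{x:\Pr_{s\sim F_S}[s\le x]\ge q\}$; $F_B$ first-order stochastically dominates $F_S$ if $b(q)\ge s(q)$ for all $q\in(0,1)$. Given buyer values sorted $b^{(1)}\ge\dots\ge b^{(m)}$ and seller values sorted $s^{(1)}\le\dots\le s^{(n)}$, let $r=\max\{i\le\min(m,n): b^{(i)}\ge s^{(i)}\}$ ($r=0$ if no such $i$). The first-best allocation trades the $r$ highest buyers with the $r$ lowest sellers, with gains from trade $\sum_{i=1}^r (b^{(i)}-s^{(i)})$; $\mathrm{OPT}(m,n)$ is its expectation. Seller Trade Reduction: set $s^{(n+1)}=\infty$; if $b^{(r)}\ge s^{(r+1)}$, the $r$ highest buyers trade with the $r$ lowest sellers (at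 price $s^{(r+1)}$); otherwise only the $r-1$ highest buyers trade with the $r-1$ lowest sellers (buyers pay $b^{(r)}$, sellers receive $s^{(r)}$). Its gains from trade is the sum of traded buyers' values minus the sum of traded sellers' values; $\mathrm{STR}(m,n)$ denotes its expectation with $m$ buyers and $n$ sellers. *)

(* Defs.v *)
From HB Require Import structures.
From mathcomp Require Import all_boot all_order all_algebra.
From mathcomp Require Import all_classical all_reals all_analysis.
Set Implicit Arguments. Unset Strict Implicit. Unset Printing Implicit Defensive.
Import Order.TTheory GRing.Theory Num.Theory.
Local Open Scope ring_scope.
Local Open Scope classical_set_scope.

Section DoubleAuction.
Variable R : realType.

Definition cdf (mu : probability R R) (x : R) : R :=
  fine (mu `]-oo, x]).

Definition quantile (mu : probability R R) (q : R) : R :=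
  inf [set x : R | q <= cdf mu x].

Definition fosd (muB muS : probability R R) : Prop :=
  forall q : R, 0 < q < 1 -> quantile muS q <= quantile muB q.

(* buyer values sorted decreasingly, seller values sorted increasingly;
   b^(i) = (bsorted bs)`_(i-1), s^(i) = (ssorted ss)`_(i-1) *)
Definition bsorted (bs : seq R) : seq R := sort (fun x y => y <= x) bs.
Definition ssorted (ss : seq R) : seq R := sort (fun x y => x <= y) ss.

Definition eff_r (bs ss : seq R) : nat :=
  (\max_(1 <= i < (minn (size bs) (size ss)).+1
          | ((ssorted ss)`_i.-1 <= (bsorted bs)`_i.-1)%R) i)%N.

Definition gft_top (bs ss : seq R) (k : nat) : R :=
  \sum_(i < k) ((bsorted bs)`_i - (ssorted ss)`_i).

Definition opt_gft (bs ss : seq R) : R := gft_top bs ss (eff_r bs ss).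

(* Seller Trade Reduction: with s^(n+1) = +oo, if b^(r) >= s^(r+1) then r trades,
   otherwise r-1 trades (for r = 0 no trade happens in either case). *)
Definition str_gft (bs ss : seq R) : R :=
  let r := eff_r bs ss in
  if (r < size ss)%N && ((ssorted ss)`_r <= (bsorted bs)`_r.-1)
  then gft_top bs ss r else gft_top bs ss r.-1.

(* expectation of f(v_1,...,v_k) for v_1..v_k i.i.d. ~ mu, as the iterated
   (Fubini-Tonelli) integral over k independent copies *)
Fixpoint iid_expect (mu : probability R R) (k : nat) (f : seq R -> \bar R) : \bar R :=
  match k with
  | 0 => f [::]
  | k'.+1 => (\int[mu]_x iid_expect mu k' (fun s => f (x :: s)))%E
  end.

Definition expected_gft (g : seq R -> seq R -> R) (muB muS : probability R R)
  (m n : nat) : \bar R :=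
  iid_expect muB m (fun bs => iid_expect muS n (fun ss => (g bs ss)%:E)).

Definition OPT muB muS m n := expected_gft opt_gft muB muS m n.
Definition STR muB muS m n := expected_gft str_gft muB muS m n.

End DoubleAuction.

(* Main.v *)
Require Import Defs.
From HB Require Import structures.
From mathcomp Require Import all_boot all_order all_algebra all_fingroup.
From mathcomp Require Import all_classical all_reals all_analysis.
From mathcomp Require Import measurable_realfun zify ring.
Set Implicit Arguments. Unset Strict Implicit. Unset Printing Implicit Defensive.
Import Order.TTheory GRing.Theory Num.Theory.

(** The constant is [c = 4]. Values are coupled through quantiles: each agent
    draws a uniform quantile, and under stochastic dominance a quantile is worth
    at least as much to a buyer as to a seller. Given the [N] quantiles of the
    augmented market, exchangeability makes their assignment to the agents a
    uniform permutation, the original market being a fixed subset of the agents.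

    For fixed quantiles, the first-best gains from trade are the integral over
    the price level [x] of [min(#buyers above x, #sellers at or below x)], and
    STR falls short of the integrand by at most 1, namely when the pair it gives
    up straddles [x] ([trade_lost]). So it suffices to show, at each level [x],
    that the permutations for which a trade is lost are outnumbered by the total
    increase of the minimum due to the extra agents. With [A], [D] the quantiles
    worth more than [x] to a buyer, resp. to a seller ([D] is included in [A]),
    and [k] the number of sellers of the augmented market, this depends on
    whether [#|D| >= k]. If so, a lost trade forces the lowest [#|D| + 1 - k]
    quantiles of [D] to belong to buyers. If not, a lost trade forces the sellers
    outside [D] to be at most as many as the buyers in [A], and then an extra
    seller outside [D] increases the minimum. *)

(** * Counting assignments of quantiles to agents *)

Section Labelings.
Import fintype boot.finset.
Variable N : nat.
Implicit Types (s : 'S_N) (P Q U V : {set 'I_N}) (E : 'S_N -> nat).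

(* [s] maps each quantile, given by its rank, to the slot of the agent who drew
   it; [hits s P U] counts the quantiles in [P] drawn by agents in [U]. *)
Definition hits s P U : nat := #|[set p in P | s p \in U]|.

Lemma hits_sum s P U : hits s P U = \sum_(p in P) (s p \in U).
Proof.
rewrite /hits -sum1dep_card big_mkcondr /=; apply: eq_bigr => p _.
by case: (s p \in U).
Qed.

(** Bijectivity of [s] is what matters: each slot of [U] receives exactly one quantile, inside [P]
    or outside it. *)
Lemma hits_setC s P U : hits s P U + hits s (~: P) U = #|U|.
Proof.
rewrite !hits_sum; transitivity (\sum_p (s p \in U) : nat).
  rewrite [RHS](bigID (mem P)) /=; congr (_ + _).
  by apply: eq_bigl => p; rewrite inE.
rewrite (reindex_inj (@perm_inj _ s^-1)) /= -sum1_card [RHS]big_mkcond /=.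
by apply: eq_bigr => i _; rewrite permKV; case: (i \in U).
Qed.

Lemma hits_setCr s P U : hits s P U + hits s P (~: U) = #|P|.
Proof.
rewrite !hits_sum -big_split /= -sum1_card; apply: eq_bigr => p _.
by rewrite inE; case: (s p \in U).
Qed.

Lemma hits_subl s P Q U : P \subset Q -> hits s P U <= hits s Q U.
Proof.
move=> /subsetP PQ; apply/subset_leq_card/subsetP => p; rewrite !inE.
by case/andP => /PQ ->.
Qed.

Lemma hits_subr s P U V : U \subset V -> hits s P U <= hits s P V.
Proof.
move=> /subsetP UV; apply/subset_leq_card/subsetP => p; rewrite !inE.
by case/andP => -> /UV.
Qed.

Lemma hits_setD s P Q U : P \subset Q -> hits s Q U = hits s P U + hits s (Q :\: P) U.
Proof.
move=> PQ; rewrite !hits_sum (big_setID P) /=; congr (_ + _).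
by apply: eq_bigl => p; rewrite inE; have /subsetP := PQ => /(_ p); case: (p \in P) => [->|]; rewrite ?andbF.
Qed.

Lemma sum_inv_perm E : \sum_s E s = \sum_s E (s^-1)%g.
Proof. exact: (reindex_inj invg_inj). Qed.

(* Transposing two slots of [V] shows that, weighted by [E], all of them receive
   a given quantile equally often. *)
Lemma hits_slot_avg E P U V :
  (forall s, {in V &, forall i j, E (s * tperm i j)%g = E s}) ->
  U \subset V ->
  #|V| * \sum_s E s * hits s P U = #|U| * \sum_s E s * hits s P V.
Proof.
move=> Einv UV.
pose w p j := \sum_s E s * (s p == j).
have wE p i j : i \in V -> j \in V -> w p i = w p j.
  move=> iV jV; rewrite /w (reindex_inj (mulIg (tperm i j))) /=.
  apply: eq_bigr => s _; rewrite Einv // permM; congr (_ * nat_of_bool _).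
  by rewrite -[RHS](inj_eq (@perm_inj _ (tperm i j))) tpermR.
have sumw (X : {set _}) :
    \sum_s E s * hits s P X = \sum_(p in P) \sum_(j in X) w p j.
  under eq_bigr do rewrite hits_sum big_distrr /=.
  rewrite exchange_big /=; apply: eq_bigr => p _.
  rewrite exchange_big /=; apply: eq_bigr => s _.
  rewrite -big_distrr /=; congr (_ * _).
  case: (boolP (s p \in X)) => [spX|spX].
    by rewrite (bigD1 (s p)) //= eqxx big1 ?addn0 // => i /andP[_]; rewrite eq_sym => /negPf->.
  by rewrite big1 // => i iX; case: eqP => // e; rewrite e iX in spX.
rewrite !sumw // !big_distrr /=; apply: eq_bigr => p _.
case: (set_0Vmem U) => [->|[i iU]]; first by rewrite big_set0 cards0 muln0.
have cst (X : {set _}) : X \subset V -> \sum_(j in X) w p j = #|X| * w p i.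
  move=> XV; rewrite -sum_nat_const; apply: eq_bigr => j jX.
  by apply: wE; [exact: (subsetP XV)|exact: (subsetP UV)].
by rewrite !cst // mulnCA.
Qed.

Lemma hits_inv s P U : hits (s^-1)%g P U = hits s U P.
Proof.
rewrite /hits -(card_imset _ (@perm_inj _ (s^-1)%g)); congr #|pred_of_set _|.
apply/setP => i; apply/imsetP/idP => [[p]|]; rewrite inE.
  by case/andP => pP pU ->; rewrite inE pU permKV.
by case/andP => iU iP; exists (s i); rewrite ?permK // inE iP permK.
Qed.

(** Dual of [hits_slot_avg]: inverting the permutation exchanges the roles of quantiles and
    slots. *)
Lemma hits_position_avg E P Q U :
  (forall s, {in Q &, forall p q, E (tperm p q * s)%g = E s}) ->
  P \subset Q ->
  #|Q| * \sum_s E s * hits s P U = #|P| * \sum_s E s * hits s Q U.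
Proof.
move=> Einv PQ; rewrite 2!(sum_inv_perm (fun s => E s * _)).
under eq_bigr do rewrite hits_inv.
under [in RHS]eq_bigr do rewrite hits_inv.
apply: (@hits_slot_avg (fun s => E (s^-1)%g)) => // s i j iQ jQ.
by rewrite invMg tpermV Einv.
Qed.

Lemma hits_tperm_out s P U p q : p \notin P -> q \notin P ->
  hits (tperm p q * s)%g P U = hits s P U.
Proof.
move=> pP qP; rewrite !hits_sum; apply: eq_bigr => i iP.
by rewrite permM tpermD //; [apply: contraNneq pP|apply: contraNneq qP] => ->.
Qed.

Lemma hits_tperm_in s P U p q : p \in P -> q \in P ->
  hits (tperm p q * s)%g P U = hits s P U.
Proof.
move=> pP qP; have := hits_setC s P U; have := hits_setC (tperm p q * s)%g P U.
by rewrite (@hits_tperm_out _ (~: P)) ?inE ?pP ?qP //; lia.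
Qed.

Lemma hits_slot_tperm s P U i j : (i \in U) = (j \in U) ->
  hits (s * tperm i j)%g P U = hits s P U.
Proof.
move=> ij; rewrite !hits_sum; apply: eq_bigr => p _.
rewrite permM; congr nat_of_bool.
by case: tpermP => [->|->|].
Qed.

End Labelings.
Lemma card_ord_itv N a b : b <= N -> #|[set j : 'I_N | a <= j < b]| = b - a.
Proof.
move=> bN; rewrite -sum1dep_card big_mkcond /=.
suff -> : \sum_(i < N) (if a <= i < b then 1 else 0) = minn N b - a by lia.
elim: N {bN} => [|N' IH]; first by rewrite big_ord0; lia.
by rewrite big_ord_recr /= IH; case: ifP; lia.
Qed.

(** * Lost trades against the gain from four extra agents on each side *)

Section Count.
Import fintype boot.finset.
Variables m n : nat.
Hypothesis nm : n <= m.
Let M := m + 4.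
Let k := n + 4.
Let N := M + k.

Definition buyer_slots : {set 'I_N} := [set j : 'I_N | 0 <= j < M].
Definition old_buyer_slots : {set 'I_N} := [set j : 'I_N | 0 <= j < m].
Definition seller_slots : {set 'I_N} := [set j : 'I_N | M <= j < N].
Definition old_seller_slots : {set 'I_N} := [set j : 'I_N | M <= j < M + n].
Local Notation bu := buyer_slots.
Local Notation bu' := old_buyer_slots.
Local Notation se := seller_slots.
Local Notation se' := old_seller_slots.

Let cardbu : #|bu| = M. Proof. by rewrite card_ord_itv ?subn0 /N; lia. Qed.
Let cardbu' : #|bu'| = m. Proof. by rewrite card_ord_itv ?subn0 /N /M; lia. Qed.
Let cardse : #|se| = k. Proof. by rewrite card_ord_itv /N; lia. Qed.
Let cardse' : #|se'| = n. Proof. by rewrite card_ord_itv /N /k; lia. Qed.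
Let sub_bu : bu' \subset bu.
Proof. by apply/subsetP => j; rewrite !inE /M; lia. Qed.
Let sub_se : se' \subset se.
Proof. by apply/subsetP => j; rewrite !inE /N /k; lia. Qed.
Lemma seller_slotsC : se = ~: bu.
Proof. by clear nm; apply/setP => j; rewrite !inE; have := ltn_ord j; lia. Qed.
Let bu_se_eq (i j : 'I_N) : (i \in se) = (j \in se) -> (i \in bu) = (j \in bu).
Proof. by rewrite seller_slotsC !inE => /negb_inj. Qed.

Variables (A D T : {set 'I_N}).
Hypothesis DA : D \subset A.
Hypothesis TD : T \subset D.
(** [T] stands for the lowest quantiles of [D], all held by buyers when a trade is lost; truncated
    subtraction makes it empty when [#|D| < k]. *)
Hypothesis cardT : #|T| = #|D|.+1 - k.
Variable L : 'S_N -> bool.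
Hypothesis L_le : forall s, L s -> hits s (~: D) se <= hits s A bu.
Hypothesis L_T : forall s, L s -> k <= #|D| -> forall p, p \in T -> s p \in bu.

Let S s := hits s (~: D) se.
Let B s := hits s A bu.
Let S' s := hits s (~: D) se'.
Let B' s := hits s A bu'.
Let Ev s : bool := S s <= B s.
Let W := \sum_(s : 'S_N) 1.

Let Ev_slot s (i j : 'I_N) : (i \in se) = (j \in se) -> Ev (s * tperm i j)%g = Ev s.
Proof.
by move=> ij; rewrite /Ev /S /B !hits_slot_tperm //; exact: bu_se_eq.
Qed.

(** Buyers and sellers inside [D] add up to [#|D|], so the comparison depends only on the buyers in
    [A :\: D]. It always holds when [k <= #|D|], and swapping two quantiles outside [A :\: D] does
    not affect it. *)
Let EvE s : Ev s = (k <= #|D| + hits s (A :\: D) bu).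
Proof.
rewrite /Ev /S /B (hits_setD _ _ DA); have := hits_setC s D se.
have := hits_setCr s D bu; rewrite -seller_slotsC cardse; lia.
Qed.

(** Exchanging two sellers preserves [Ev], so on this event the original sellers hold a share
    [n / k] of the total [S]. *)
Let avg_se : k * \sum_s Ev s * S' s = n * \sum_s Ev s * S s.
Proof.
rewrite -cardse -cardse' (@hits_slot_avg _ (fun s => Ev s : nat)) // => s i j iV jV.
by rewrite Ev_slot ?iV ?jV.
Qed.

Let avg_bu : M * \sum_s ~~ Ev s * B' s = m * \sum_s ~~ Ev s * B s.
Proof.
rewrite -cardbu -cardbu' (@hits_slot_avg _ (fun s => ~~ Ev s : nat)) // => s i j iV jV.
by rewrite Ev_slot // seller_slotsC !inE; move: iV jV; rewrite !inE => -> ->.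
Qed.

Let avg_S : N * \sum_s S s = k * ((N - #|D|) * W).
Proof.
have := @hits_slot_avg N (fun=> 1) (~: D) se [set: 'I_N]%SET (fun _ _ _ _ _ => erefl) (subsetT _).
rewrite cardsT card_ord cardse; under eq_bigr do rewrite mul1n.
move=> ->; congr (_ * _); rewrite /W big_distrr /=; apply: eq_bigr => s _.
have := hits_setC s D [set: 'I_N]%SET; have := hits_setCr s D [set: 'I_N]%SET.
have : hits s D (~: [set: 'I_N]%SET) = 0 by rewrite hits_sum big1 // => p; rewrite !inE.
by rewrite cardsT card_ord => ->; rewrite addn0 mul1n muln1 => -> e; rewrite -[X in X - _]e addKn.
Qed.

Let X := \sum_s Ev s * S s.
Let Y := \sum_s ~~ Ev s * B s.
Let P := \sum_s (Ev s : nat).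
Let G := \sum_s minn (B s) (S s) - \sum_s minn (B' s) (S' s).
Let Lo := \sum_s (L s : nat).

Let S'S s : S' s <= S s. Proof. exact: hits_subr. Qed.
Let B'B s : B' s <= B s. Proof. exact: hits_subr. Qed.

(** The minimum is [S] on [Ev] and [B] off it, while in the original market [S'] and [B'] bound it
    from above. By the averages these amount to [n / k] of [X] and [m / M] of [Y], so the extra
    agents supply at least the remaining [4 / k] and [4 / M]. *)
Let gain : 4 * X * M + 4 * Y * k <= G * (k * M).
Proof.
pose X' := \sum_s Ev s * S' s; pose Y' := \sum_s ~~ Ev s * B' s.
have e : \sum_s minn (B s) (S s) = X + Y.
  rewrite /X /Y -big_split /=; apply: eq_bigr => s _.
  by rewrite /Ev; case: (leqP (S s) (B s)); lia.
have e' : \sum_s minn (B' s) (S' s) <= X' + Y'.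
  rewrite /X' /Y' -big_split /=; apply: leq_sum => s _.
  by rewrite /Ev; case: (leqP (S s) (B s)); lia.
have hX : k * X' = n * X := avg_se.
have hY : M * Y' = m * Y := avg_bu.
have eX : k * (X - X') = 4 * X by rewrite mulnBr hX -mulnBl addKn.
have eY : M * (Y - Y') = 4 * Y by rewrite mulnBr hY -mulnBl addKn.
have X'X : X' <= X by apply: leq_sum => s _; rewrite leq_mul2l S'S orbT.
have Y'Y : Y' <= Y by apply: leq_sum => s _; rewrite leq_mul2l B'B orbT.
have -> : 4 * X * M + 4 * Y * k = (X - X' + (Y - Y')) * (k * M).
  by rewrite -eX -eY; ring.
by rewrite leq_mul2r; apply/orP; right; rewrite /G e; lia.
Qed.

Let Lo_le_W : Lo <= W. Proof. by apply: leq_sum => s _; case: (L s). Qed.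
Let Lo_le_P : Lo <= P.
Proof. by apply: leq_sum => s _; case: (boolP (L s)) => // /L_le; rewrite /Ev => ->. Qed.

Let cardsCN (Q : {set 'I_N}) : #|~: Q| = N - #|Q|.
Proof. by rewrite -[X in X - _](card_ord N) -(cardsC Q) addKn. Qed.
Let Dle : #|D| <= N. Proof. by rewrite -[X in _ <= X]card_ord max_card. Qed.

(* If [T] is all buyers and [q] a seller, moving the seller of [q] to each of the
   other places of [q |: T] gives [#|T|.+1] disjoint equiprobable events. *)
Let loss_swap q : q \notin D ->
  #|T|.+1 * \sum_s (hits s T se == 0) * (s q \in se) <= W.
Proof.
move=> qD; have qT : q \notin T by apply: contra qD; exact: subsetP.
have hV s : hits s (q |: T) se = (s q \in se) + hits s T se.
  by rewrite !hits_sum big_setU1.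
pose E s : nat := hits s (q |: T) se == 1.
have := @hits_position_avg N E [set q] (q |: T) se.
rewrite cardsU1 qT cards1 mul1n add1n => H.
apply: (@leq_trans (#|T|.+1 * \sum_s E s * hits s [set q] se)).
  rewrite leq_mul2l /=; apply: leq_sum => s _.
  by rewrite (hits_sum s [set q]) big_set1 /E hV; case: (s q \in se); case: (hits s T se).
rewrite H ?subsetUl // => [|s i j iV jV]; last by rewrite /E hits_tperm_in.
by apply: leq_sum => s _; rewrite /E; case: eqP => [->|].
Qed.

Let case1 : k <= #|D| -> Lo <= G.
Proof.
move=> kD.
have EvT s : Ev s by rewrite EvE; exact: leq_trans (leq_addr _ _).
have XE : X = \sum_s S s by apply: eq_bigr => s _; rewrite EvT mul1n.
have H : 4 * ((N - #|D|) * W) <= G * N.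
  have kM0 : 0 < k * M by rewrite muln_gt0 /k /M !addn4.
  rewrite -(leq_pmul2r kM0).
  have -> : 4 * ((N - #|D|) * W) * (k * M) = 4 * (k * ((N - #|D|) * W)) * M by ring.
  rewrite -avg_S -XE.
  have -> : 4 * (N * X) * M = N * (4 * X * M) by ring.
  have -> : G * N * (k * M) = N * (G * (k * M)) by ring.
  by rewrite leq_mul2l (leq_trans _ gain) ?orbT ?leq_addr.
have N0 : 0 < N by rewrite /N /M addn4.
(* [H] bounds [G] below by [4 * (N - #|D|) * W / N], which is at least [W] unless [D] holds more
   than three quarters of the quantiles. In that case [T] has nearly [N / 4] elements or more, as
   [2 * k <= N], and [loss_swap] bounds [Lo] by the same quantity. *)
have [N4|N4] := leqP N (4 * (N - #|D|)).
  apply: leq_trans Lo_le_W _; rewrite -(leq_pmul2l N0) [N * G]mulnC.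
  by apply: leq_trans H; rewrite mulnA leq_mul2r N4 orbT.
have T4 : N <= 4 * #|T|.+1 by rewrite cardT; move: N4 Dle kD; rewrite /N /M /k; lia.
rewrite -(leq_pmul2l N0) [N * G]mulnC.
apply: leq_trans H; apply: (@leq_trans (4 * #|T|.+1 * Lo)).
  by rewrite leq_mul2r T4 orbT.
rewrite -mulnA leq_mul2l /=.
(* [D :\: T] has [k - 1] elements, so when [T] holds no seller, one of the [k] sellers is outside
   [D]. A union bound over its quantile [q] then leads to [loss_swap]. *)
apply: (@leq_trans (#|T|.+1 * \sum_s \sum_(q in ~: D) (hits s T se == 0) * (s q \in se))).
  rewrite leq_mul2l /=; apply: leq_sum => s _; case: (boolP (L s)) => // Ls.
  have T0 : hits s T se = 0.
    rewrite hits_sum big1 // => p pT.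
    by rewrite seller_slotsC inE (L_T Ls).
  rewrite T0 eqxx; under eq_bigr do rewrite mul1n.
  rewrite -hits_sum.
  have := hits_setC s D se; rewrite cardse (hits_setD _ _ TD) T0.
  have := hits_setCr s (D :\: T) se; rewrite cardsD (setIidPr TD) cardT.
  by move: kD; rewrite /k; lia.
rewrite exchange_big big_distrr /=.
rewrite -cardsCN.
rewrite -sum_nat_const; apply: leq_sum => q; rewrite inE; exact: loss_swap.
Qed.

Let case2 : #|D| < k -> Lo <= G.
Proof.
move=> dk; apply: leq_trans Lo_le_P _.
have k0 : 0 < k by rewrite /k addn4.
have M0 : 0 < M by rewrite /M addn4.
have N0 : 0 < N by rewrite /N addn_gt0 M0.
have kN : 2 * k <= N by rewrite /N /k /M; lia.
have gX : 4 * X <= G * k.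
  rewrite -(leq_pmul2r M0) -[G * k * M]mulnA (leq_trans _ gain) //.
  exact: leq_addr.
(* Many quantiles outside [A]: [Ev] only concerns [A :\: D], so given [Ev] the
   sellers spread evenly over [D] and the complement of [A]. Few of them: then
   [B s] is at least half of its maximum, so the gain is large on both [Ev] and
   its complement. *)
have [aN|aN] := leqP N (4 * (N - #|A|)).
  pose V := D :|: ~: A.
  have VD0 : D :&: ~: A = set0.
    by apply/eqP; rewrite setI_eq0 disjoints_subset setCK.
  have cardV : #|V| = #|D| + (N - #|A|).
    by rewrite cardsU VD0 cards0 subn0 cardsCN.
  have := @hits_position_avg N (fun s => Ev s : nat) (~: A) V se.
  pose Z := \sum_s Ev s * hits s D se; pose XA := \sum_s Ev s * hits s (~: A) se.
  have -> : \sum_s Ev s * hits s V se = Z + XA.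
    rewrite /Z /XA -big_split /=; apply: eq_bigr => s _.
    rewrite -mulnDr; congr (_ * _); rewrite (hits_setD _ _ (subsetUl D _)); congr (_ + hits _ _ _).
    by rewrite setDUl setDv set0U; apply/setDidPl; rewrite disjoint_sym disjoints_subset setCK.
  rewrite cardV cardsCN.
  move=> H; have {}H : (#|D| + (N - #|A|)) * XA = (N - #|A|) * (Z + XA).
    apply: H (subsetUr _ _) => s i j iV jV.
    have notAD x : x \in V -> x \notin A :\: D.
      by rewrite !inE => /orP[->|/negPf->]; rewrite ?andbF.
    by rewrite !EvE hits_tperm_out ?notAD.
  have XAX : XA <= X.
    by apply: leq_sum => s _; rewrite leq_mul2l hits_subl ?orbT ?setCS.
  have kP : k * P = X + Z.
    rewrite /X /Z /P -big_split big_distrr /=; apply: eq_bigr => s _.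
    by rewrite -mulnDr addnC hits_setC cardse mulnC.
  (* The even spread gives [Z] as [#|D| / (N - #|A|)] times [XA], and
     [#|D| < k <= N / 2 <= 2 * (N - #|A|)]. With [kP] this yields [k * P <= 3 * X], within the gain
     [4 * X]. *)
  have ZX : Z <= 2 * X.
    have A0 : 0 < N - #|A| by move: aN N0; lia.
    rewrite -(leq_pmul2l A0).
    have -> : (N - #|A|) * Z = #|D| * XA by move: H; lia.
    rewrite mulnA leq_mul //; move: dk kN aN; lia.
  by rewrite -(leq_pmul2l k0) [k * G]mulnC (leq_trans _ gX) // kP; lia.
(* Fewer than [N / 4 <= M / 2] quantiles lie outside [A], hence fewer than [M / 2] buyers do. *)
have BM s : M <= 2 * B s.
  have := hits_setC s A bu; have := hits_setCr s (~: A) bu; rewrite cardbu.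
  rewrite cardsCN.
  have kM : k <= M by rewrite leq_add2r.
  have NE : N = M + k by [].
  rewrite /B; move: (hits s A bu) (hits s (~: A) bu) (hits s _ (~: bu)) => x y z.
  by move: aN kM NE; move: (N - #|A|) => a'; move: N M k => N' M' k'; lia.
pose Q := \sum_s (~~ Ev s : nat).
have PQ : P + Q = W by rewrite -big_split /=; apply: eq_bigr => s _; case: (Ev s).
have YQ : M * Q <= 2 * Y.
  rewrite /Q /Y !big_distrr; apply: leq_sum => s _ /=.
  by case: (Ev s); rewrite ?mul0n ?muln0 // muln1 mul1n.
have SX : \sum_s S s <= X + k * Q.
  rewrite /X /Q big_distrr -big_split; apply: leq_sum => s _ /=.
  case: (Ev s); rewrite ?mul1n ?leq_addr //= mul0n muln1 add0n -cardse.
  by rewrite -(hits_setC s D se) leq_addl.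
(* The mean of [S] is [k * (N - #|D|) / N], at least [k / 2] since [#|D| < k <= N / 2]; off [Ev],
   [S] is at most [k]. *)
have kW : k * W <= 2 * (X + k * Q).
  apply: (@leq_trans (2 * \sum_s S s)); last by rewrite leq_mul2l SX orbT.
  rewrite -(leq_pmul2l N0) mulnCA [X in _ <= X]mulnCA avg_S.
  rewrite [2 * _]mulnCA leq_mul2l mulnA leq_mul2r; apply/orP; right; apply/orP; right.
  by move: dk kN; lia.
rewrite -(leq_pmul2l k0) [k * G]mulnC -(leq_pmul2r M0) -[G * k * M]mulnA.
rewrite -(leq_pmul2l (isT : 0 < 2)).
apply: (@leq_trans (2 * (4 * X * M + 4 * Y * k))); last by rewrite leq_mul2l gain orbT.
apply: (@leq_trans (8 * X * M + 4 * (M * Q) * k)); last first.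
  have -> : 2 * (4 * X * M + 4 * Y * k) = 8 * X * M + 4 * (2 * Y) * k by ring.
  by rewrite leq_add2l leq_mul2r leq_mul2l YQ !orbT.
have -> : 2 * (k * P * M) = 2 * (k * P) * M by ring.
have -> : 8 * X * M + 4 * (M * Q) * k = 4 * (2 * X + k * Q) * M by ring.
rewrite leq_mul2r; apply/orP; right.
have kWE : k * W = k * P + k * Q by rewrite -mulnDr PQ.
by move: kW; rewrite kWE mulnDr; lia.
Qed.

Lemma augmentation_beats_loss :
  \sum_s minn (B' s) (S' s) + Lo <= \sum_s minn (B s) (S s).
Proof.
have GL : Lo <= G by have [/case1|/case2] := leqP k #|D|.
have : \sum_s minn (B' s) (S' s) <= \sum_s minn (B s) (S s).
  by apply: leq_sum => s _; have := S'S s; have := B'B s; lia.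
by move: GL; rewrite /G; lia.
Qed.
End Count.

Local Open Scope ring_scope.

(** * Gains from trade by price level *)

Section Layers.
Variable R : realType.
Implicit Types (bs ss t : seq R) (x y : R) (i j : nat).

(** Strict for buyers and weak for sellers, so that a pair counts on the half-open interval from
    cost to value, of length its gain. *)
Definition buyers_above bs x : nat := count (fun b => x < b) bs.
Definition sellers_below ss x : nat := count (fun s => s <= x) ss.

Lemma bsorted_sorted bs : sorted >=%R (bsorted bs).
Proof. by apply: sort_sorted => x y; exact: ge_total. Qed.

Lemma ssorted_sorted ss : sorted <=%R (ssorted ss).
Proof. by apply: sort_sorted => x y; exact: le_total. Qed.

(** In a sorted list, a predicate inherited by earlier entries holds exactly on a prefix, whose
    length is the count. *)
Lemma nth_sorted_count t (r : rel R) (a : pred R) i :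
  transitive r -> sorted r t -> {in t &, forall y z, r y z -> a z -> a y} ->
  (i < count a t)%N = (i < size t)%N && a t`_i.
Proof.
move=> rtr; elim: t i => [|y t IH] i //= pt ady.
have st := path_sorted pt.
have /(IH) {}IH : {in t &, forall y z, r y z -> a z -> a y}.
  by move=> u v ut vt; apply: ady; rewrite inE ?ut ?vt orbT.
have [ay|nay] := boolP (a y); first by case: i => [|i] //=; rewrite add1n !ltnS IH.
have tn z : z \in t -> ~~ a z.
  move=> zt; apply: contra nay; apply: ady; rewrite ?inE ?eqxx ?zt ?orbT //.
  by move: pt; rewrite path_sortedE // => /andP[/allP/(_ z zt)].
rewrite (_ : count a t = 0)%N //; last first.
  by apply/eqP; rewrite -leqn0 leqNgt -has_count; apply/hasPn.
rewrite addn0 /= ltn0; case: i => [|i] /=; first by rewrite (negPf nay).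
by rewrite ltnS; case: (ltnP i (size t)) => //= it; rewrite (negPf (tn _ (mem_nth 0 it))).
Qed.

Lemma lt_buyers_above bs x i :
  (i < buyers_above bs x)%N = (i < size bs)%N && (x < (bsorted bs)`_i).
Proof.
rewrite /buyers_above; have /seq.permP/(_ (fun b => x < b)) <- := permEl (perm_sort (fun x y => y <= x) bs).
rewrite (nth_sorted_count _ _ (bsorted_sorted bs)) ?size_sort //.
  by move=> u v w vu uw; exact: le_trans uw vu.
by move=> u v _ _ vu xv; exact: lt_le_trans xv vu.
Qed.

Lemma lt_sellers_below ss x i :
  (i < sellers_below ss x)%N = (i < size ss)%N && ((ssorted ss)`_i <= x).
Proof.
rewrite /sellers_below; have /seq.permP/(_ (fun b => b <= x)) <- := permEl (perm_sort (fun x y => x <= y) ss).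
rewrite (nth_sorted_count _ _ (ssorted_sorted ss)) ?size_sort //.
  exact: le_trans.
by move=> u v _ _ vu xv; exact: le_trans vu xv.
Qed.

Lemma bsorted_le bs i j : (i <= j < size bs)%N -> (bsorted bs)`_j <= (bsorted bs)`_i.
Proof.
move=> /andP[ij js]; have is_ := leq_ltn_trans ij js.
by apply: (sorted_leq_nth ge_trans ge_refl 0 (bsorted_sorted bs)); rewrite ?inE ?size_sort.
Qed.

Lemma ssorted_le ss i j : (i <= j < size ss)%N -> (ssorted ss)`_i <= (ssorted ss)`_j.
Proof.
move=> /andP[ij js]; have is_ := leq_ltn_trans ij js.
by apply: (sorted_leq_nth le_trans _ 0 (ssorted_sorted ss)) => //=; rewrite ?inE ?size_sort.
Qed.

Lemma eff_r_le bs ss : (eff_r bs ss <= minn (size bs) (size ss))%N.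
Proof. by apply/bigmax_leqP_seq => i; rewrite mem_index_iota => /andP[]. Qed.

(** [eff_r] is only a maximum over indices; the condition passes to all smaller indices because
    buyer values decrease and seller values increase. *)
Lemma lt_eff_r bs ss i : (i < eff_r bs ss)%N =
  (i < minn (size bs) (size ss))%N && ((ssorted ss)`_i <= (bsorted bs)`_i).
Proof.
case: (ltnP i (minn _ _)) => [imn|imn] /=; last by apply/negbTE; rewrite -leqNgt (leq_trans (eff_r_le _ _)).
apply/idP/idP => [|sb]; last first.
  by apply: (@leq_bigmax_seq _ _ _ id i.+1); rewrite // mem_index_iota /= ltnS.
apply: contraTT => nsb; rewrite -leqNgt; apply/bigmax_leqP_seq => -[|j] //.
rewrite mem_index_iota /= ltnS => jmn sbj; rewrite ltnNge.
apply: contra nsb => ij; move: jmn; rewrite leq_min => /andP[jb js].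
apply: le_trans (le_trans (ssorted_le _) sbj) (bsorted_le _); exact/andP.
Qed.

Lemma opt_gftE bs ss : opt_gft bs ss =
  \sum_(i < minn (size bs) (size ss) | (ssorted ss)`_i <= (bsorted bs)`_i)
     ((bsorted bs)`_i - (ssorted ss)`_i).
Proof.
rewrite /opt_gft /gft_top (big_ord_widen _ (fun i => (bsorted bs)`_i - (ssorted ss)`_i) (eff_r_le bs ss)).
by apply: eq_bigl => i; rewrite lt_eff_r ltn_ord.
Qed.

(* The [i]-th best pair trades in STR iff the buyer's value is at least the cost
   of the next seller; this covers both branches of the definition. *)
Lemma str_gftE bs ss : str_gft bs ss =
  \sum_(i < minn (size bs) (size ss).-1 | (ssorted ss)`_i.+1 <= (bsorted bs)`_i)
     ((bsorted bs)`_i - (ssorted ss)`_i).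
Proof.
pose F i := (bsorted bs)`_i - (ssorted ss)`_i.
pose r := eff_r bs ss.
pose cond := (r < size ss)%N && ((ssorted ss)`_r <= (bsorted bs)`_r.-1).
pose r' := if cond then r else r.-1.
have -> : str_gft bs ss = \sum_(i < r') F i by rewrite /str_gft -/r /r' -/cond; case: ifP.
have r'P i : (i < r')%N = (i < minn (size bs) (size ss).-1)%N &&
    ((ssorted ss)`_i.+1 <= (bsorted bs)`_i).
  have rP := lt_eff_r bs ss; rewrite -/r in rP.
  have [imn|imn] /= := ltnP i (minn (size bs) (size ss).-1); last first.
    apply/negbTE; rewrite -leqNgt (leq_trans _ imn) // leq_min.
    have := eff_r_le bs ss; rewrite -/r leq_min => /andP[rm rn].
    by rewrite /r' /cond; case: ifP => [/andP[]|_]; lia.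
  move: (imn); rewrite leq_min => /andP[im in_].
  have i1n : (i.+1 < size ss)%N by lia.
  have ssi : (ssorted ss)`_i <= (ssorted ss)`_i.+1 by apply: ssorted_le; lia.
  apply/idP/idP => [ir'|sb]; last first.
    have ir : (i < r)%N by rewrite rP (le_trans ssi sb) leq_min im ltnW.
    rewrite /r'; case: ifP => // /negbT ncond.
    have [//|ri] := ltnP i r.-1; have {ri} ri : r = i.+1 by lia.
    by move: ncond; rewrite /cond ri /= i1n sb.
  have [i1r|ri] := ltnP i.+1 r.
    move: (i1r); rewrite rP => /andP[+ /le_trans]; rewrite leq_min => /andP[i1m _].
    by apply; apply: bsorted_le; lia.
  move: ir'; rewrite /r' /cond; case: ifP => [/andP[_ c] ir|_]; last by lia.
  by have re : r = i.+1 by [lia]; move: c; rewrite re.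
have r'le : (r' <= minn (size bs) (size ss).-1)%N.
  by have := r'P (minn (size bs) (size ss).-1); rewrite ltnn; case: ltnP.
by rewrite (big_ord_widen _ F r'le); apply: eq_bigl => i; rewrite r'P ltn_ord.
Qed.

Definition opt_layer bs ss x : nat := minn (buyers_above bs x) (sellers_below ss x).

Definition str_layer bs ss x : nat :=
  (\sum_(i < minn (size bs) (size ss).-1 | ((ssorted ss)`_i.+1 <= (bsorted bs)`_i)%R)
     ((ssorted ss)`_i <= x < (bsorted bs)`_i)%R)%N.

Lemma opt_layerE bs ss x : opt_layer bs ss x =
  (\sum_(i < minn (size bs) (size ss) | ((ssorted ss)`_i <= (bsorted bs)`_i)%R)
     ((ssorted ss)`_i <= x < (bsorted bs)`_i)%R)%N.
Proof.
rewrite big_mkcond /=.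
transitivity (\sum_(i < minn (size bs) (size ss)) (i < opt_layer bs ss x))%N.
  have : (opt_layer bs ss x <= minn (size bs) (size ss))%N.
    by rewrite /opt_layer leq_min !geq_min !count_size orbT.
  move=> /minn_idPl {1}<-; elim: (minn (size bs) (size ss)) => [|l IH].
    by rewrite big_ord0 minn0.
  by rewrite big_ord_recr /= -IH; lia.
apply: eq_bigr => i _; have := ltn_ord i; rewrite [(i < minn _ _)%N]leq_min => /andP[ib is_].
rewrite leq_min lt_buyers_above lt_sellers_below ib is_ /=.
have [sb|bs_] := leP (ssorted ss)`_i (bsorted bs)`_i; first by rewrite andbC.
by case: (ltP x) => //= xb; rewrite leNgt (lt_trans xb bs_).
Qed.

(* The witness [y] is the value of the lowest buyer matched by the first best,
   whose seller is at or below [x]. *)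
Definition trade_lost bs ss x : Prop := exists2 y, x < y &
  [/\ (buyers_above bs y < sellers_below ss x)%N,
      (sellers_below ss x <= buyers_above bs x)%N &
      sellers_below ss y = sellers_below ss x].

(** Of the first [opt_layer] pairs, which straddle [x], all but the last trade in STR: the next
    seller is still at or below [x], hence below the buyer's value. If the last one fails, no cost
    lies above [x] and at most its buyer's value, and that value witnesses [trade_lost]. *)
Lemma opt_layer_le_str bs ss x :
  (opt_layer bs ss x <= str_layer bs ss x + `[< trade_lost bs ss x >])%N.
Proof.
pose q := opt_layer bs ss x.
have qb : (q <= buyers_above bs x)%N by rewrite geq_minl.
have qs : (q <= sellers_below ss x)%N by rewrite geq_minr.
have qmn : (q <= size bs)%N by rewrite (leq_trans qb) ?count_size.
have qmn' : (q <= size ss)%N by rewrite (leq_trans qs) ?count_size.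
have prev i : (i.+1 < q)%N -> (i < minn (size bs) (size ss).-1)%N &&
    ((ssorted ss)`_i.+1 <= (bsorted bs)`_i) && ((ssorted ss)`_i <= x < (bsorted bs)`_i).
  move=> iq.
  have := leq_trans iq qs; rewrite lt_sellers_below => /andP[i1 s1].
  have := leq_trans (ltnW iq) qs; rewrite lt_sellers_below => /andP[i2 s2].
  have := leq_trans (ltnW iq) qb; rewrite lt_buyers_above => /andP[i3 b3].
  by rewrite s2 b3 (le_trans s1 (ltW b3)) !andbT leq_min i3; lia.
have low l : (l <= q)%N -> (forall i, (i < l)%N -> (i < minn (size bs) (size ss).-1)%N &&
    ((ssorted ss)`_i.+1 <= (bsorted bs)`_i) && ((ssorted ss)`_i <= x < (bsorted bs)`_i)) ->
    (l <= str_layer bs ss x)%N.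
  move=> lq H.
  have lmn : (l <= minn (size bs) (size ss).-1)%N.
    by case: l {lq} H => // l /(_ l (ltnSn l)); case/andP => /andP[].
  have <- : (\sum_(i < l) 1 = l)%N by rewrite sum_nat_const card_ord muln1.
  rewrite (big_ord_widen _ (fun=> 1%N) lmn) /str_layer.
  rewrite [leqLHS]big_mkcond [leqRHS]big_mkcond; apply: leq_sum => i _ /=.
  by case: ifP => // /H /andP[/andP[_ ->] ->].
have [q0|q0] := posnP q; first by rewrite -/q q0.
have [lost|/asboolP] := boolP `[< trade_lost bs ss x >].
  by rewrite -/q -(prednK q0) addn1 ltnS; apply: low => [|i iq]; [lia|apply: prev; lia].
move=> nlost; rewrite addn0 -/q; apply: low => // i iq.
have [i1q|] := ltnP i.+1 q; first exact: prev.
move=> qi; have {qi} qi : q = i.+1 by lia.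
have := leq_trans iq qs; rewrite lt_sellers_below => /andP[is_ sx].
have := leq_trans iq qb; rewrite lt_buyers_above => /andP[ib bx].
rewrite sx bx !andbT leq_min ib /=.
apply: contra_notT nlost => nt.
have sS y : x <= y -> y <= (bsorted bs)`_i -> sellers_below ss y = i.+1.
  move=> xy yb; apply/eqP; rewrite eqn_leq; apply/andP; split; last first.
    by rewrite lt_sellers_below is_ (le_trans sx xy).
  rewrite leqNgt lt_sellers_below; apply: contra nt => /andP[i1 s1].
  by rewrite (le_trans s1 yb); lia.
exists (bsorted bs)`_i => //; rewrite !sS ?lexx // ?ltW //; split=> //.
  by rewrite ltnS leqNgt lt_buyers_above ltxx andbF.
by rewrite lt_buyers_above ib.
Qed.

End Layers.

(** * Counting in permuted sequences *)

Lemma count_take_drop (T : Type) (x0 : T) (P : pred T) (t : seq T) a b :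
  count P (take b (drop a t)) =
  (\sum_(i < size t) ((a <= i < a + b) && P (nth x0 t i)))%N.
Proof.
elim: t a b => [|y t IH] a b /=; first by rewrite big_ord0.
rewrite big_ord_recl /=; case: a => [|a] /=; last by rewrite IH.
case: b => [|b] /=; first by rewrite big1.
by rewrite -[t in LHS]drop0 IH.
Qed.

Section PermutedSeq.
Import fintype boot.finset.
Variables (T : Type) (x0 : T) (N : nat).

Definition perm_seq (s : 'S_N) (us : seq T) : seq T :=
  [seq nth x0 us (s i) | i <- enum 'I_N].

Lemma size_perm_seq s us : size (perm_seq s us) = N.
Proof. by rewrite size_map size_enum_ord. Qed.

Lemma nth_perm_seq s us (i : 'I_N) : nth x0 (perm_seq s us) i = nth x0 us (s i).
Proof. by rewrite (nth_map i) ?size_enum_ord // nth_ord_enum. Qed.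

Lemma perm_seqM s s' us : perm_seq s (perm_seq s' us) = perm_seq (s * s')%g us.
Proof. by apply: eq_map => i; rewrite nth_perm_seq permM. Qed.

(** [perm_seq] reads the permutation from slots to positions of quantiles, [hits] from quantiles to
    slots; hence the inverse. *)
Lemma count_perm_seq (P : pred T) s us a b : (a + b <= N)%N ->
  count P (take b (drop a (perm_seq s us))) =
  hits s^-1 [set p : 'I_N | P (nth x0 us p)] [set j : 'I_N | (a <= j < a + b)%N].
Proof.
move=> abN; rewrite (count_take_drop x0) size_perm_seq hits_inv hits_sum.
rewrite [RHS]big_mkcond; apply: eq_bigr => i _.
by rewrite nth_perm_seq !inE; case: ifP.
Qed.

End PermutedSeq.

(** * Comparison of the two markets at one price level, for fixed quantiles *)

Section Pointwise.
Import fintype boot.finset.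
(** [r] ranks quantiles from high to low. It is a preorder only: distinct reals may be clamped to
    the same quantile. *)
Variables (R : realType) (beta varsigma : R -> R) (r : rel R).
Hypothesis r_trans : transitive r.
Hypothesis r_total : total r.
Hypothesis varsigma_r : forall u v, r u v -> varsigma v <= varsigma u.
Hypothesis varsigma_beta : forall u, varsigma u <= beta u.
Variables m n : nat.
Hypothesis nm : (n <= m)%N.
Let M := (m + 4)%N.
Let k := (n + 4)%N.
Let N := (M + k)%N.

Definition market_opt us x : nat :=
  opt_layer (map beta (take m us)) (map varsigma (take n (drop M us))) x.
Definition market_str us x : nat :=
  str_layer (map beta (take M us)) (map varsigma (drop M us)) x.

Section Sorted.
Variables (us : seq R) (x : R).
Hypothesis sus : size us = N.
Hypothesis sorted_us : sorted r us.
Let A y : {set 'I_N} := [set p : 'I_N | y < beta us`_p].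
Let D y : {set 'I_N} := [set p : 'I_N | y < varsigma us`_p].
Let d := #|D x|.
(** Positions start from the highest quantile, so [D x] is the initial segment of length [d] (see
    [mem_D]) and [T] is its tail. Starting at [k.-1] means that a position in [T] and those before
    it number at least [k]. *)
Let T : {set 'I_N} := [set p : 'I_N | (k.-1 <= p < d)%N].
Let bu := buyer_slots m n.
Let se := seller_slots m n.

Let seE : se = ~: bu. Proof. exact: seller_slotsC. Qed.

Let DA y : D y \subset A y.
Proof. by apply/subsetP => p; rewrite !inE => /lt_le_trans; apply. Qed.

Let nth_r (i j : nat) : (i <= j < N)%N -> r us`_i us`_j.
Proof.
move=> /andP[ij jN]; have r_refl : reflexive r by move=> u; have := r_total u u; rewrite orbb.
by apply: (sorted_leq_nth r_trans r_refl) => //; rewrite inE sus // (leq_ltn_trans ij jN).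
Qed.

Let mem_D p : (p \in D x) = (p < d)%N.
Proof.
have dE : d = count (fun u => x < varsigma u) us.
  rewrite /d -sum1_card big_mkcond /=.
  have := count_take_drop 0 (fun u => x < varsigma u) us 0 N.
  rewrite drop0 take_oversize ?sus // => ->; apply: eq_bigr => i _.
  by rewrite inE leq0n add0n ltn_ord; case: (_ < _).
rewrite dE (nth_sorted_count _ r_trans sorted_us) ?sus ?ltn_ord ?inE //.
by move=> u v _ _ /varsigma_r vu /lt_le_trans; apply.
Qed.

Let bs (s : 'S_N) := map beta (take M (perm_seq 0 s us)).
Let ss (s : 'S_N) := map varsigma (drop M (perm_seq 0 s us)).

Let buyers_aboveE s y : buyers_above (bs s) y = hits (s^-1)%g (A y) bu.
Proof.
rewrite /buyers_above /bs count_map -[perm_seq _ _ _]drop0 count_perm_seq //.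
exact: leq_addr.
Qed.

Let sellers_belowE s y : sellers_below (ss s) y = hits (s^-1)%g (~: D y) se.
Proof.
rewrite /sellers_below /ss count_map -[drop M _](@take_oversize _ k); last first.
  by rewrite size_drop size_perm_seq addKn.
rewrite count_perm_seq //; congr hits; apply/setP => p.
by rewrite !inE /= leNgt.
Qed.

(** Suppose a seller holds [p] in [T]. No cost lies between [x] and [y], so [p] is in [D y], and the
    segment [P] up to [p] lies in [A y] and in [D x]. Its buyers number at most [buyers_above] at
    [y], less than [sellers_below] at [x], which is [k] minus the sellers in [D x]. So [P] has fewer
    than [k] elements, against the choice of [T]. *)
Let lost_buyers s : trade_lost (bs s) (ss s) x -> (k <= d)%N ->
  forall p, p \in T -> (s^-1)%g p \in bu.
Proof.
case=> y xy; rewrite !buyers_aboveE !sellers_belowE => -[By _ Sy] kd p.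
rewrite inE => /andP[kp pd]; apply: contraT => pbu.
have sp : (s^-1)%g p \in se by rewrite seE finset.in_setC.
have Dyx : D y \subset D x by apply/subsetP => q; rewrite !inE; exact: lt_trans.
have pDx : p \in D x by rewrite mem_D.
have pDy : p \in D y.
  have := hits_setC (s^-1)%g (D x) se; have := hits_setC (s^-1)%g (D y) se.
  rewrite (hits_setD _ _ Dyx) => eDy eDx; apply: contraT => pDy.
  have pDD : p \in D x :\: D y by rewrite in_setD pDy.
  have : (0 < hits (s^-1)%g (D x :\: D y) se)%N.
    by apply/card_gt0P; exists p; rewrite inE; apply/andP; split.
  by move: Sy eDy eDx; lia.
pose P : {set 'I_N} := [set q : 'I_N | (0 <= q < p.+1)%N].
have cP : #|P| = p.+1 by rewrite card_ord_itv.
have PA : P \subset A y.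
  apply: subset_trans (DA y); apply/subsetP => q; rewrite inE ltnS /= => qp; rewrite inE.
  move: pDy; rewrite inE => /lt_le_trans; apply; apply: varsigma_r.
  by apply: nth_r; rewrite qp ltn_ord.
have PD : P \subset D x.
  by apply/subsetP => q; rewrite inE mem_D ltnS => /leq_ltn_trans; apply.
have := hits_setC (s^-1)%g (D x) se; have := hits_setCr (s^-1)%g P bu.
have := hits_subl (s^-1)%g bu PA; have := hits_subl (s^-1)%g se PD.
rewrite -seE cP.
have -> : #|se| = k by rewrite card_ord_itv ?addKn.
by move: By kp; rewrite /k; lia.
Qed.

Lemma sorted_market_opt_le_str :
  (\sum_(s : 'S_N) market_opt (perm_seq 0%R s us) x <=
   \sum_(s : 'S_N) market_str (perm_seq 0%R s us) x)%N.
Proof.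
rewrite (reindex_inj invg_inj) [leqRHS](reindex_inj invg_inj) /=.
pose L (s : 'S_N) := `[< trade_lost (bs s^-1) (ss s^-1) x >].
have TD : T \subset D x.
  by apply/subsetP => p; rewrite inE mem_D => /andP[].
have cT : #|T| = (#|D x|.+1 - k)%N.
  rewrite card_ord_itv; first by rewrite /d /k; lia.
  by rewrite /d -[X in (_ <= X)%N](card_ord N) max_card.
have := @augmentation_beats_loss m n nm (A x) (D x) T (DA x) TD cT L.
(* With lost trades added on both sides, the chain is: original optimum plus losses, augmented
   optimum, augmented STR plus losses. *)
move=> H; rewrite -(leq_add2r (\sum_s (L s : nat))).
apply: (leq_trans _ (leq_trans (H _ _) _)).
- rewrite leq_add2r; apply: leq_sum => s _; rewrite /market_opt /opt_layer.
  rewrite /buyers_above /sellers_below !count_map -[X in take m X]drop0.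
  rewrite !count_perm_seq ?invgK; try by rewrite /N /M /k; lia.
  have -> : ~: D x = [set p : 'I_N | preim varsigma (fun u => u <= x) us`_p].
    by apply/setP => p; rewrite !inE /= leNgt.
  exact: leqnn.
- by move=> s /asboolP[y _ [_ + _]]; rewrite buyers_aboveE sellers_belowE invgK.
- by move=> s /asboolP/lost_buyers H' kd p pT; move: (H' kd p pT); rewrite invgK.
rewrite -big_split; apply: leq_sum => s _ /=.
apply: leq_trans (opt_layer_le_str _ _ _).
by rewrite /opt_layer buyers_aboveE sellers_belowE invgK.
Qed.

End Sorted.

(** The permutation that sorts [us] is absorbed by reindexing the sums over all permutations. *)
Lemma market_opt_le_str us x : size us = N ->
  (\sum_(s : 'S_N) market_opt (perm_seq 0%R s us) x <=
   \sum_(s : 'S_N) market_str (perm_seq 0%R s us) x)%N.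
Proof.
move=> sus; pose vs := sort r us.
have svs : size vs = N by rewrite size_sort.
have [t /= usE] : exists t : 'S_N, us = perm_seq 0 t vs.
  have st : size us == N by rewrite sus.
  have sv : size vs == N by rewrite svs.
  have /tuple_permP[t tE] : perm_eq (Tuple st) (Tuple sv) by rewrite /= perm_sym perm_sort.
  exists t; rewrite /= in tE; rewrite {1}tE; apply: eq_map => i.
  by rewrite (tnth_nth 0).
rewrite usE; under eq_bigr do rewrite perm_seqM.
under [leqRHS]eq_bigr do rewrite perm_seqM.
have := sorted_market_opt_le_str x svs (sort_sorted r_total us).
by rewrite (reindex_inj (mulIg t)) [leqRHS](reindex_inj (mulIg t)).
Qed.

End Pointwise.

(** * Iterated expectations *)

Section IidExpectation.
Local Open Scope ereal_scope.
Variable R : realType.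
Implicit Types (mu : probability R R) (f g : seq R -> \bar R) (k : nat).

(* Joint measurability in [k] real variables, phrased through composition so that
   no measurable structure on sequences is needed. *)
Definition seq_measurable k f : Prop :=
  forall d (T : measurableType d) (xs : seq (T -> R)), size xs = k ->
    (forall i, measurable_fun setT (nth (fun=> 0%R) xs i)) ->
    measurable_fun setT ((fun w => f [seq h w | h <- xs]) : T -> \bar R).

Lemma nth_cat_measurable d (T : measurableType d) (xs ys : seq (T -> R)) :
  (forall i, measurable_fun setT (nth (fun=> 0%R) xs i)) ->
  (forall i, measurable_fun setT (nth (fun=> 0%R) ys i)) ->
  forall i, measurable_fun setT (nth (fun=> 0%R) (xs ++ ys) i).
Proof. by move=> mx my i; rewrite nth_cat; case: ifP. Qed.

Lemma nth_map_measurable d (T : measurableType d) d' (T' : measurableType d')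
    (xs : seq (T -> R)) (p : T' -> T) : measurable_fun setT p ->
  (forall i, measurable_fun setT (nth (fun=> 0%R) xs i)) ->
  forall i, measurable_fun setT (nth (fun=> 0%R) [seq h \o p | h <- xs] i).
Proof.
move=> mp mx i; have [il|il] := ltnP i (size xs); last first.
  by rewrite nth_default ?size_map//; exact: measurable_cst.
by rewrite (nth_map (fun=> 0%R))//; exact: measurableT_comp.
Qed.

Lemma nth_seq1_measurable d (T : measurableType d) (h : T -> R) :
  measurable_fun setT h ->
  forall i, measurable_fun setT (nth (fun=> 0%R) [:: h] i).
Proof. by move=> mh [|i] //=; rewrite nth_nil; exact: measurable_cst. Qed.

Lemma seq_measurable_ext k f g : (forall s, size s = k -> f s = g s) ->
  seq_measurable k f -> seq_measurable k g.
Proof.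
move=> fg mf d T xs sxs mxs; have := mf _ _ _ sxs mxs.
by congr measurable_fun; apply/funext => w; rewrite fg// size_map.
Qed.

Lemma seq_measurable_cons k f x :
  seq_measurable k.+1 f -> seq_measurable k (fun s => f (x :: s)).
Proof.
move=> mf d T xs sxs mxs.
apply: (mf _ _ ((fun=> x) :: xs)); rewrite /= ?sxs// => -[|i] //=.
Qed.

Lemma iid_expect_ge0 mu k f : (forall s, 0 <= f s) -> 0 <= iid_expect mu k f.
Proof.
by elim: k f => [|k IH] f f0 //=; apply: integral_ge0 => x _; apply: IH.
Qed.

Lemma iid_expect_ext mu k f g : (forall s, size s = k -> f s = g s) ->
  iid_expect mu k f = iid_expect mu k g.
Proof.
elim: k f g => [|k IH] f g fg /=; first exact: fg.
by apply: eq_integral => x _; apply: IH => s sk; apply: fg; rewrite /= sk.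
Qed.

Lemma iid_expect_cat mu j k f :
  iid_expect mu (j + k) f =
  iid_expect mu j (fun s => iid_expect mu k (fun t => f (s ++ t))).
Proof.
by elim: j f => [|j IH] f //=; apply: eq_integral => x _; rewrite IH.
Qed.

Lemma iid_expect_cst mu k (c : \bar R) : iid_expect mu k (fun=> c) = c.
Proof.
elim: k => [|k IH] //=; under eq_integral do rewrite IH.
by have /= -> := integral_cst mu measurableT c; rewrite probability_setT mule1.
Qed.

(** Induction on [k], with [j] general: the next variable to integrate joins the free ones as the
    second coordinate of [T * R], and Tonelli makes the partial integral measurable. *)
Lemma iid_expect_measurable mu j k f : (forall s, 0 <= f s) ->
  seq_measurable (j + k) f ->
  seq_measurable j (fun s => iid_expect mu k (fun t => f (s ++ t))).
Proof.
move=> f0; elim: k j => [|k IH] j mf /=.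
  rewrite addn0 in mf; apply: (@seq_measurable_ext _ f) => // s _.
  by rewrite cats0.
rewrite addnS -addSn in mf => d T xs sxs mxs.
pose F (p : T * R) := iid_expect mu k (fun t => f ([seq h p.1 | h <- xs] ++ p.2 :: t)).
have mF : measurable_fun setT F.
  have := IH _ mf _ (T * R)%type (rcons [seq h \o fst | h <- xs] snd).
  rewrite size_rcons size_map sxs => /(_ erefl) H.
  apply: eq_measurable_fun (H _) => [p _|i].
    rewrite map_rcons -map_comp; apply: iid_expect_ext => t _.
    by rewrite cat_rcons.
  rewrite -cats1; apply: nth_cat_measurable.
    exact: nth_map_measurable.
  exact: nth_seq1_measurable.
apply: (@measurable_fun_fubini_tonelli_F _ _ T R R mu F) => // p.
exact: iid_expect_ge0.
Qed.

Lemma iid_expect_cons_measurable mu k f : (forall s, 0 <= f s) ->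
  seq_measurable k.+1 f ->
  measurable_fun setT ((fun x => iid_expect mu k (fun s => f (x :: s))) : R -> \bar R).
Proof.
move=> f0 mf; have := @iid_expect_measurable mu 1 k f f0 mf _ R [:: idfun] erefl.
by apply; apply: nth_seq1_measurable; exact: measurable_id.
Qed.

Lemma iid_expect_le mu k f g : (forall s, 0 <= f s) -> (forall s, 0 <= g s) ->
  seq_measurable k f -> seq_measurable k g ->
  (forall s, size s = k -> f s <= g s) -> iid_expect mu k f <= iid_expect mu k g.
Proof.
elim: k f g => [|k IH] f g f0 g0 mf mg fg /=; first exact: fg.
apply: ge0_le_integral => //.
- by move=> x _; exact: iid_expect_ge0.
- exact: iid_expect_cons_measurable.
- exact: iid_expect_cons_measurable.
move=> x _; apply: IH => //; [exact: seq_measurable_cons..|] => s sk.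
by apply: fg; rewrite /= sk.
Qed.

Lemma seq_measurable_sum (I : Type) (r : seq I) k (F : I -> seq R -> \bar R) :
  (forall i, seq_measurable k (F i)) ->
  seq_measurable k (fun s => \sum_(i <- r) F i s).
Proof.
move=> mF d T xs sxs mxs.
apply: (@emeasurable_sum _ _ R setT I r (fun i w => F i [seq h w | h <- xs])).
by move=> i; exact: (mF i _ _ xs).
Qed.

Lemma iid_expect_sum mu (I : Type) (r : seq I) k (F : I -> seq R -> \bar R) :
  (forall i s, 0 <= F i s) -> (forall i, seq_measurable k (F i)) ->
  iid_expect mu k (fun s => \sum_(i <- r) F i s) =
  \sum_(i <- r) iid_expect mu k (F i).
Proof.
elim: k F => [|k IH] F F0 mF //=.
transitivity (\int[mu]_x \sum_(i <- r) iid_expect mu k (fun s => F i (x :: s))).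
  apply: eq_integral => x _; apply: (IH (fun i s => F i (x :: s))) => // i.
  exact: seq_measurable_cons.
rewrite ge0_integral_sum// => [i|i x _]; first exact: iid_expect_cons_measurable.
exact: iid_expect_ge0.
Qed.

(** The outermost variable is moved innermost by successive exchanges with its neighbour. *)
Lemma iid_expect_fubini mu k f : (forall s, 0 <= f s) -> seq_measurable k.+1 f ->
  iid_expect mu k.+1 f = iid_expect mu k (fun s => \int[mu]_x f (x :: s)).
Proof.
elim: k f => [|k IH] f f0 mf //=.
transitivity (\int[mu]_y \int[mu]_x iid_expect mu k (fun s => f (x :: y :: s))).
  pose F (p : R * R) := iid_expect mu k (fun s => f (p.1 :: p.2 :: s)).
  apply: (@fubini_tonelli _ _ R R R mu mu F); last by move=> p; exact: iid_expect_ge0.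
  apply: (@iid_expect_measurable mu 2 k f f0 mf _ (R * R)%type [:: fst; snd] erefl).
  by move=> [|[|i]] //=; rewrite nth_nil; exact: measurable_cst.
apply: eq_integral => y _.
(* [f'] freezes the second variable at [y]; the default [0] of [head] is not reached on sequences of
   size [k.+1]. *)
pose f' s := f (head 0%R s :: y :: behead s).
apply: (IH f') => [s|d T xs sxs mxs]; first exact: f0.
case: xs sxs mxs => // h xs [sxs] mxs.
apply: (mf _ _ [:: h, (fun=> y) & xs]); first by rewrite /= sxs.
move=> [|[|i]] /=; [exact: (mxs 0%N)|exact: measurable_cst|exact: (mxs i.+1)].
Qed.

(** Induction on [k]: the index of the innermost variable is taken out of [idx], and its integral,
    at the place it occupied, is absorbed in [f']. The induction hypothesis reorders the other
    variables, and [iid_expect_fubini] restores the order of integration. *)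
Lemma iid_expect_perm mu k f (idx : seq nat) : (forall s, 0 <= f s) ->
  seq_measurable k f -> perm_eq idx (iota 0 k) ->
  iid_expect mu k (fun s => f [seq nth 0%R s i | i <- idx]) = iid_expect mu k f.
Proof.
elim: k f idx => [|k IH] f idx f0 mf.
  by move=> /perm_size/size0nil ->.
move=> idxP; have kidx : k \in idx.
  by rewrite (perm_mem idxP) mem_iota leq0n add0n ltnSn.
case/splitPr: kidx idxP => i1 i2; rewrite -addn1 iotaD /= add0n => idxP.
have {}idxP : perm_eq (i1 ++ i2) (iota 0 k).
  move: idxP; rewrite (perm_catCA i1 [:: k] i2) perm_sym (perm_catC (iota 0 k) [:: k]).
  rewrite perm_cons.
  by rewrite perm_sym.
have mem_lt i : i \in i1 ++ i2 -> (i < k)%N.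
  by rewrite (perm_mem idxP) mem_iota add0n.
pose f' s := \int[mu]_x f (take (size i1) s ++ x :: drop (size i1) s).
have szi := perm_size idxP; rewrite size_cat size_iota in szi.
transitivity (iid_expect mu k (fun s => f' [seq nth 0%R s i | i <- i1 ++ i2])).
  rewrite iid_expect_cat; apply: iid_expect_ext => s sk /=.
  apply: eq_integral => x _; congr f.
  rewrite !map_cat /= take_size_cat ?drop_size_cat ?size_map//.
  rewrite nth_cat sk ltnn subnn /=.
  by congr (_ ++ _ :: _); apply/eq_in_map => i ii; rewrite nth_cat sk mem_lt// mem_cat ii ?orbT.
have mf' : seq_measurable k f'.
  move=> d T xs sxs mxs.
  pose F (p : T * R) := f [seq h p | h <- [seq h \o fst | h <- take (size i1) xs] ++ snd :: [seq h \o fst | h <- drop (size i1) xs]].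
  have mF : measurable_fun setT F.
    apply: mf.
      by rewrite size_cat /= !size_map addnS -size_cat cat_take_drop sxs.
    have mx1 i : measurable_fun setT (nth (fun=> 0%R) [seq h \o fst | h <- xs] i : T * R -> R).
      exact: nth_map_measurable.
    apply: nth_cat_measurable => [i|[|i] //=].
      rewrite map_take; have [il|il] := ltnP i (size i1).
        by rewrite nth_take.
      by rewrite nth_default ?size_take_min ?geq_min ?il//; exact: measurable_cst.
    by rewrite map_drop nth_drop.
  have F0 p : 0 <= F p by exact: f0.
  apply: eq_measurable_fun (@measurable_fun_fubini_tonelli_F _ _ T R R mu F mF F0) => // w _.
  apply: eq_integral => x _ /=; rewrite /F map_cat /= -!map_comp.
  by rewrite -map_take -map_drop.
rewrite IH//; last by move=> s; apply: integral_ge0.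
have -> : (k + 1 = size i1 + (size i2).+1)%N by rewrite addn1 addnS szi.
rewrite -[in LHS]szi !iid_expect_cat.
apply: iid_expect_ext => s sz; rewrite iid_expect_fubini//.
  apply: iid_expect_ext => t _; apply: eq_integral => x _.
  by rewrite take_size_cat ?drop_size_cat.
move=> d T xs sxs mxs.
have := mf _ T ([seq (fun=> y) | y <- s] ++ xs).
rewrite size_cat size_map sz sxs addnS szi => /(_ erefl) H.
apply: eq_measurable_fun (H _) => [w _|]; first by rewrite map_cat -map_comp map_id.
apply: nth_cat_measurable => // i; have [il|il] := ltnP i (size s).
  by rewrite (nth_map 0%R)//; exact: measurable_cst.
by rewrite nth_default ?size_map//; exact: measurable_cst.
Qed.

Lemma iid_expect_pushforward mu (nu : probability R R) (phi : R -> R) k f :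
  measurable_fun setT phi ->
  (forall A, measurable A -> mu A = nu (phi @^-1` A)%classic) ->
  (forall s, 0 <= f s) -> seq_measurable k f ->
  iid_expect mu k f = iid_expect nu k (fun s => f (map phi s)).
Proof.
move=> mphi muE f0; elim: k f f0 => [|k IH] f f0 mf //=.
rewrite (eq_measure_integral (pushforward nu phi)); last by move=> A mA _; exact: muE.
rewrite ge0_integral_pushforward//; last by move=> x _; exact: iid_expect_ge0.
  apply: eq_integral => x _ /=; rewrite IH//; exact: seq_measurable_cons.
exact: iid_expect_cons_measurable.
Qed.

End IidExpectation.

(** * Measurability and layer-cake formulas *)

Section GftMeasurability.
Local Open Scope classical_set_scope.
Context d (T : measurableType d) (R : realType).
Implicit Types (xs : seq (T -> R)).

Let measurable_coords xs := forall i, measurable_fun setT (nth (fun=> 0) xs i).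

Lemma measurable_count xs (P : pred R) i :
  (forall j, measurable [set w | P (nth (fun=> 0) xs j w)]) ->
  measurable [set w | (i < count P [seq h w | h <- xs])%N].
Proof.
elim: xs i => [|h xs IH] i mP /=.
  by rewrite [X in measurable X](_ : _ = set0)//; apply/seteqP; split.
have {}IH j : measurable [set w | (j < count P [seq h w | h <- xs])%N].
  by apply: IH => l; exact: (mP l.+1).
have mh : measurable [set w | P (h w)] := mP 0%N.
case: i => [|i].
  rewrite [X in measurable X](_ : _ = [set w | P (h w)] `|`
      [set w | (0 < count P [seq h w | h <- xs])%N]); first exact: measurableU.
  apply/seteqP; split => w /=; first by case: (P (h w)) => /=; [left|right].
  by case=> [->//|]; rewrite addn_gt0 orbC => ->.
rewrite [X in measurable X](_ : _ = ([set w | P (h w)] `&`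
    [set w | (i < count P [seq h w | h <- xs])%N]) `|`
    [set w | (i.+1 < count P [seq h w | h <- xs])%N]).
  by apply: measurableU => //; exact: measurableI.
apply/seteqP; split => w /=.
  by case: (P (h w)) => /=; [left|right].
by case=> [[-> ?]//|h1]; exact: leq_trans h1 (leq_addl _ _).
Qed.

Lemma measurable_fun_gt (f : T -> R) :
  (forall y, measurable [set w | y < f w]) -> measurable_fun setT f.
Proof.
move=> mf; apply: (measurability _ (RGenOInfty.measurableE R)) => //.
move=> _ [_ [y ->] <-]; rewrite setTI.
by rewrite [X in measurable X](_ : _ = [set w | y < f w]) //;
  apply/seteqP; split => w /=; rewrite in_itv /= andbT.
Qed.

Lemma measurable_gt (f : T -> R) y : measurable_fun setT f ->
  measurable [set w | y < f w].
Proof.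
move=> mf; have := mf measurableT `]y, +oo[ (measurable_itv _); rewrite setTI.
by congr measurable; apply/seteqP; split => w /=; rewrite in_itv /= andbT.
Qed.

(** An order statistic exceeds [y] exactly when more than [i] values do, so counts settle
    measurability. *)
Lemma measurable_bsorted xs i : measurable_coords xs ->
  measurable_fun setT (fun w => (bsorted [seq h w | h <- xs])`_i).
Proof.
move=> mx; have [il|il] := ltnP i (size xs); last first.
  under eq_fun do rewrite nth_default ?size_sort ?size_map//.
  exact: measurable_cst.
apply: measurable_fun_gt => y.
rewrite [X in measurable X](_ : _ = [set w | (i < buyers_above [seq h w | h <- xs] y)%N]).
  by apply: measurable_count => j; exact: measurable_gt.
by apply/seteqP; split => w /=; rewrite lt_buyers_above size_map il.
Qed.

Lemma measurable_ssorted xs i : measurable_coords xs ->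
  measurable_fun setT (fun w => (ssorted [seq h w | h <- xs])`_i).
Proof.
move=> mx; have [il|il] := ltnP i (size xs); last first.
  under eq_fun do rewrite nth_default ?size_sort ?size_map//.
  exact: measurable_cst.
apply: measurable_fun_gt => y.
rewrite [X in measurable X](_ : _ = ~` [set w | (i < sellers_below [seq h w | h <- xs] y)%N]).
  apply: measurableC; apply: measurable_count => j.
  rewrite [X in measurable X](_ : _ = ~` [set w | y < nth (fun=> 0) xs j w]).
    by apply: measurableC; exact: measurable_gt.
  by apply/seteqP; split => w /=; rewrite leNgt => /negP.
apply/seteqP; split => w /=; rewrite lt_sellers_below size_map il /= leNgt.
  by move=> ->.
by move=> /negP; rewrite negbK.
Qed.

(** The offset [j] serves both mechanisms: [0] for the first best, [1] for the comparison with the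
    next seller in STR. *)
Lemma measurable_trades xs ys N j : measurable_coords xs -> measurable_coords ys ->
  measurable_fun setT (fun w =>
    let b := bsorted [seq h w | h <- xs] in
    let s := ssorted [seq h w | h <- ys] in
    (\sum_(i < N | s`_(i + j) <= b`_i) (b`_i - s`_i))%:E : \bar R).
Proof.
move=> mx my /=; apply/measurable_EFinP.
under eq_fun do rewrite big_mkcond /=.
apply: (@measurable_sum _ _ R setT 'I_N _
  (fun i w => if (ssorted [seq h w | h <- ys])`_(i + j) <= (bsorted [seq h w | h <- xs])`_i
    then (bsorted [seq h w | h <- xs])`_i - (ssorted [seq h w | h <- ys])`_i else 0)) => i.
apply: measurable_fun_ifT; last exact: measurable_cst.
  by apply: measurable_fun_ler; [exact: measurable_ssorted|exact: measurable_bsorted].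
by apply: measurable_funB; [exact: measurable_bsorted|exact: measurable_ssorted].
Qed.

Lemma measurable_opt_gft xs ys : measurable_coords xs -> measurable_coords ys ->
  measurable_fun setT (fun w => (opt_gft [seq h w | h <- xs] [seq h w | h <- ys])%:E : \bar R).
Proof.
move=> mx my; apply: eq_measurable_fun (measurable_trades (minn (size xs) (size ys)) 0 mx my).
by move=> w _ /=; rewrite opt_gftE !size_map; under eq_bigl do rewrite addn0.
Qed.

Lemma measurable_str_gft xs ys : measurable_coords xs -> measurable_coords ys ->
  measurable_fun setT (fun w => (str_gft [seq h w | h <- xs] [seq h w | h <- ys])%:E : \bar R).
Proof.
move=> mx my; apply: eq_measurable_fun (measurable_trades (minn (size xs) (size ys).-1) 1 mx my).
by move=> w _ /=; rewrite str_gftE !size_map; under eq_bigl do rewrite addn1.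
Qed.

End GftMeasurability.

Section LayerCake.
Variable R : realType.
Local Open Scope ereal_scope.
Local Notation mu := (@lebesgue_measure R).

Let indic_layer (s b x : R) : ((s <= x < b)%R : nat)%:R%:E = (\1_(`[s, b[%classic) x)%:E :> \bar R.
Proof. by rewrite indicE mem_setE /= in_itv /=; case: (_ && _). Qed.

Lemma measurable_layer (s b : R) :
  measurable_fun setT (fun x : R => ((s <= x < b)%R : nat)%:R%:E : \bar R).
Proof.
under eq_fun do rewrite indic_layer.
by apply/measurable_EFinP; exact: measurable_indic.
Qed.

Lemma integral_layer (s b : R) : (s <= b)%R ->
  \int[mu]_x ((s <= x < b)%R : nat)%:R%:E = (b - s)%:E.
Proof.
move=> sb; under eq_integral do rewrite indic_layer.
rewrite integral_indic// setIT.
have := lebesgue_measure_itv (`[s, b[); rewrite /= lte_fin => ->.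
by move: sb; rewrite le_eqVlt => /orP[/eqP->|->] //; rewrite ltxx subrr.
Qed.

Let sum_layersE N (c : pred 'I_N) (s b : 'I_N -> R) (x : R) :
  (\sum_(i < N | c i) (s i <= x < b i)%R)%N%:R%:E =
  \sum_(i <- [seq i <- enum 'I_N | c i]) ((s i <= x < b i)%R : nat)%:R%:E :> \bar R.
Proof.
by rewrite natr_sum -sumEFin big_filter [in RHS]big_enum_cond; apply: eq_bigl => i; rewrite inE.
Qed.

Lemma measurable_layers N (c : pred 'I_N) (s b : 'I_N -> R) :
  measurable_fun setT (fun x : R =>
    (\sum_(i < N | c i) (s i <= x < b i)%R)%N%:R%:E : \bar R).
Proof.
under eq_fun do rewrite sum_layersE.
by apply: emeasurable_sum => i; exact: measurable_layer.
Qed.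

Lemma integral_layers N (c : pred 'I_N) (s b : 'I_N -> R) :
  (forall i, c i -> s i <= b i)%R ->
  \int[mu]_x (\sum_(i < N | c i) (s i <= x < b i)%R)%N%:R%:E =
  (\sum_(i < N | c i) (b i - s i))%:E.
Proof.
move=> sb; under eq_integral do rewrite sum_layersE.
rewrite ge0_integral_sum//; last by move=> i; exact: measurable_layer.
rewrite -sumEFin big_filter [in LHS]big_enum_cond.
by apply: eq_bigr => i ci; rewrite integral_layer// sb.
Qed.

Lemma opt_gft_layers (bs ss : seq R) :
  (opt_gft bs ss)%:E = \int[mu]_x (opt_layer bs ss x)%:R%:E.
Proof.
rewrite opt_gftE -integral_layers//.
by apply: eq_integral => x _; rewrite opt_layerE.
Qed.

Lemma str_gft_layers (bs ss : seq R) :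
  (str_gft bs ss)%:E = \int[mu]_x (str_layer bs ss x)%:R%:E.
Proof.
rewrite str_gftE -integral_layers// => i; apply: le_trans.
by apply: ssorted_le; have := ltn_ord i; lia.
Qed.

Lemma measurable_opt_layer (bs ss : seq R) :
  measurable_fun setT (fun x : R => (opt_layer bs ss x)%:R%:E : \bar R).
Proof. by under eq_fun do rewrite opt_layerE; exact: measurable_layers. Qed.

Lemma measurable_str_layer (bs ss : seq R) :
  measurable_fun setT (fun x : R => (str_layer bs ss x)%:R%:E : \bar R).
Proof. exact: measurable_layers. Qed.

(** Nonnegativity of the gains puts the later exchanges of integrals within reach of Tonelli's
    theorem. *)
Lemma opt_gft_ge0 (bs ss : seq R) : 0 <= (opt_gft bs ss)%:E.
Proof. by rewrite opt_gft_layers; apply: integral_ge0 => x _; rewrite lee_fin. Qed.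

Lemma str_gft_ge0 (bs ss : seq R) : 0 <= (str_gft bs ss)%:E.
Proof. by rewrite str_gft_layers; apply: integral_ge0 => x _; rewrite lee_fin. Qed.

End LayerCake.

(** * Quantile coupling *)

Section Quantile.
Import numFieldNormedType.Exports.
Variable R : realType.
Implicit Types (mu : probability R R) (x q u : R).
Local Open Scope classical_set_scope.

Lemma cdfE mu x : (Defs.cdf mu x)%:E = mu `]-oo, x].
Proof. by rewrite /Defs.cdf fineK// fin_num_measure. Qed.

Lemma cdf_itv01 mu x : 0 <= Defs.cdf mu x <= 1.
Proof.
by rewrite -!lee_fin cdfE measure_ge0/= probability_le1.
Qed.

(** Seeing [mu] as the law of the identity gives access to the limits and right continuity of
    distribution functions. *)
Let id_fun : R -> R := idfun.
Let mid_fun : measurable_fun setT id_fun := @measurable_id _ R setT.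
Let idRV : {mfun R >-> R} := HB.pack id_fun (isMeasurableFun.Build _ _ _ _ _ mid_fun).

Let cdf_RV mu : Defs.cdf mu = fine \o random_variable.cdf (P := mu) idRV.
Proof. by []. Qed.

(** The set of levels is nonempty and bounded below because the cdf tends to [1] and to [0]; right
    continuity makes its infimum a member. *)
Lemma quantile_le mu q x : 0 < q < 1 -> (quantile mu q <= x) = (q <= Defs.cdf mu x).
Proof.
move=> /andP[q0 q1].
have nd : {homo Defs.cdf mu : y z / y <= z}.
  move=> y z yz; rewrite -lee_fin !cdfE; apply: le_measure; rewrite ?inE//.
  by apply: subset_itvl; rewrite bnd_simp.
pose A := [set z | q <= Defs.cdf mu z].
have A0 : A !=set0.
  have : Defs.cdf mu z @[z --> +oo%R] --> (1 : R).
    by rewrite cdf_RV; apply/fine_cvg/cvg_cdfy1.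
  move=> /cvgr_gt/(_ q q1) [z0 [_ h]].
  by exists (z0 + 1); apply: ltW; apply: h; rewrite ltrDl.
have lbA : has_lbound A.
  have : Defs.cdf mu z @[z --> -oo%R] --> (0 : R).
    by rewrite cdf_RV; apply/fine_cvg/cvg_cdfNy0.
  move=> /cvgr_lt/(_ q q0) [z0 [_ h]].
  exists (z0 - 1) => z /= qz; rewrite leNgt; apply/negP => zz.
  have : Defs.cdf mu z < q by apply: h; rewrite (lt_trans zz)// ltrBlDr ltrDl.
  by rewrite ltNge qz.
apply/idP/idP => [qx|qx]; last exact: ge_inf.
have rc : Defs.cdf mu z @[z --> x^'+] --> Defs.cdf mu x.
  rewrite cdf_RV; apply: fine_cvg; rewrite fineK ?fin_num_measure//.
  exact: cdf_right_continuous.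
rewrite leNgt; apply/negP => cx.
have /cvgr_lt/(_ q cx) h := rc.
have [e /= e0 he] := h.
have [z Az zx] : exists2 z, A z & z < x + e.
  have [z Az zq] := inf_adherent e0 (conj A0 lbA).
  by exists z => //; rewrite (lt_le_trans zq)// lerD2r.
have xz : x < z.
  rewrite ltNge; apply/negP => zx'.
  by have := le_trans Az (nd _ _ zx'); rewrite leNgt cx.
have : Defs.cdf mu z < q.
  apply: he => //=; rewrite distrC ger0_norm ?subr_ge0 ?ltW//.
  by rewrite ltrBlDl.
by rewrite ltNge Az.
Qed.

(* [quantile mu] is meaningful on ]0, 1[ only: there it is monotone in the level,
   while elsewhere [inf] may return a junk value. *)
Definition unit_clamp u : R := if 0 < u < 1 then u else 2^-1.

Lemma unit_clamp_itv u : 0 < unit_clamp u < 1.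
Proof.
rewrite /unit_clamp; case: ifP => // _.
by rewrite invr_gt0 ltr0n invf_lt1 ?ltr1n ?ltr0n.
Qed.

(* Inverse transform sampling: [quantile_fun mu] sends the uniform law on [0, 1] to [mu]. *)
Definition quantile_fun mu u : R := quantile mu (unit_clamp u).

Lemma quantile_fun_mono mu u v : unit_clamp v <= unit_clamp u ->
  quantile_fun mu v <= quantile_fun mu u.
Proof.
move=> vu; rewrite quantile_le ?unit_clamp_itv// (le_trans vu)//.
by rewrite -quantile_le ?unit_clamp_itv.
Qed.

Let clamp_le c : [set u | unit_clamp u <= c] =
  (`]0, 1[ `&` `]-oo, c]) `|` (~` `]0, 1[ `&` [set _ | 2^-1 <= c]).
Proof.
apply/seteqP; split => u; rewrite /unit_clamp /= !in_itv /=.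
  by case: ifP => h uc; [left|right]; split.
by case=> -[h ?]; [rewrite h|case: ifP].
Qed.

Let measurable_clamp_le c : measurable [set u : R | unit_clamp u <= c].
Proof.
rewrite clamp_le; apply: measurableU.
  by apply: measurableI.
apply: measurableI; first exact: measurableC.
have [h|h] := boolP (2^-1 <= c).
  by rewrite [X in measurable X](_ : _ = setT)//; apply/seteqP; split.
rewrite [X in measurable X](_ : _ = set0)//.
by apply/seteqP; split => // u /=; rewrite (negPf h).
Qed.

Let quantile_fun_le mu x : [set u | quantile_fun mu u <= x] =
  [set u | unit_clamp u <= Defs.cdf mu x].
Proof. by apply/seteqP; split => u /=; rewrite quantile_le ?unit_clamp_itv. Qed.

Lemma measurable_quantile_fun mu : measurable_fun setT (quantile_fun mu).
Proof.
apply: measurable_fun_gt => y.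
rewrite [X in measurable X](_ : _ = ~` [set u | quantile_fun mu u <= y]).
  by apply: measurableC; rewrite quantile_fun_le.
by apply/seteqP; split => u /=; rewrite ltNge => /negP.
Qed.

(* The library's uniform law lives on a differently displayed copy of the Borel
   space [R]; this is the same law on [R] itself. *)
Let to_R : measurableTypeR R -> R := idfun.
Let measurable_to_R : measurable_fun setT to_R.
Proof. by move=> _ Y mY; rewrite setTI. Qed.
Let to_RV : {mfun measurableTypeR R >-> R} :=
  HB.pack to_R (isMeasurableFun.Build _ _ _ _ _ measurable_to_R).
Definition uniform01 : probability R R := distribution (uniform_prob (@ltr01 R)) to_RV.
Local Notation unif := uniform01.
Local Notation leb := (@lebesgue_measure R).

(** Within [[0, 1]] the clamp moves only the two endpoints, a null set, so the event is squeezed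
    between []0, c[] and []0, c]] with the endpoints added. *)
Lemma uniform_clamp_le c : 0 <= c <= 1 -> unif [set u | unit_clamp u <= c] = c%:E.
Proof.
move=> /andP[c0 c1].
pose E := [set u : R | unit_clamp u <= c].
have mE : measurable E by exact: measurable_clamp_le.
have -> : unif E = leb (E `&` `[0, 1]).
  rewrite -[LHS]/(uniform_prob (@ltr01 R) E).
  have := @integral_uniform R 0 1 ltr01 (fun u => (\1_E u)%:E).
  rewrite integral_indic// setIT => -> //; first last.
    by apply/measurable_EFinP; exact: measurable_indic.
  by rewrite subr0 invr1 mul1e integral_indic.
have lebU A B : measurable A -> measurable B -> (leb (A `|` B) <= leb A + leb B)%E.
  by move=> mA mB; exact: measureU2.
apply/eqP; rewrite eq_le; apply/andP; split.
  apply: (@le_trans _ _ (leb ([set 0] `|` (`]0, c] `|` [set 1])))).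
    apply: le_measure; rewrite ?inE.
    - exact: measurableI.
    - by apply: measurableU => //; exact: measurableU.
    move=> u [] /=; rewrite !in_itv /= /E /unit_clamp /= => uc /andP[u0 u1].
    move: u0; rewrite le_eqVlt => /orP[/eqP<-|u0]; first by left.
    move: u1; rewrite le_eqVlt => /orP[/eqP->|u1]; first by right; right.
    by right; left; move: uc; rewrite u0 u1.
  apply: le_trans (lebU _ _ _ _) _ => //; first exact: measurableU.
  rewrite lebesgue_measure_set1 add0e.
  apply: le_trans (lebU _ _ _ _) _ => //.
  rewrite lebesgue_measure_set1 adde0 lebesgue_measure_itv/= lte_fin.
  by case: ifP; rewrite ?sube0.
have [->|cn0] := eqVneq c 0; first exact: measure_ge0.
have {cn0} c0' : 0 < c by rewrite lt_neqAle eq_sym cn0.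
apply: (@le_trans _ _ (leb `]0, c[)).
  by rewrite lebesgue_measure_itv/= lte_fin c0' sube0.
apply: le_measure; rewrite ?inE//; first exact: measurableI.
move=> u /=; rewrite !in_itv /= /E /unit_clamp /= => /andP[u0 uc].
by rewrite u0 (lt_le_trans uc c1) /= !ltW// (lt_le_trans uc c1).
Qed.

(** The two laws agree on the rays []x, +oo[], which are stable under intersection and generate the
    Borel sets. *)
Lemma quantile_fun_pushforward mu A : measurable A ->
  mu A = unif (quantile_fun mu @^-1` A).
Proof.
move=> mA; have mq := measurable_quantile_fun mu.
pose Q : {mfun R >-> R} := HB.pack (quantile_fun mu) (isMeasurableFun.Build _ _ _ _ _ mq).
rewrite -[RHS]/(distribution unif Q A).
apply: (@measure_unique _ R R (@RGenOInfty.G R) (fun n => `](- n%:R)%R, +oo[)) => //.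
- exact: RGenOInfty.measurableE.
- move=> _ _ [x ->] [y ->]; exists (Num.max x y).
  by apply/seteqP; split => z /=; rewrite !in_itv /= !andbT gt_max => /andP.
- by move=> n; exists (- n%:R).
- apply/seteqP; split => // z _; exists (Num.truncn `|z|).+1 => //=.
  rewrite in_itv /= andbT ltrNl (le_lt_trans (ler_norm _))// normrN.
  exact: truncnS_gt.
- move=> _ [x ->]; rewrite -[RHS]/(unif (quantile_fun mu @^-1` `]x, +oo[)).
  have mp : measurable (quantile_fun mu @^-1` `]-oo, x]).
    by rewrite -[X in measurable X]setTI; exact: (mq measurableT `]-oo, x] (measurable_itv _)).
  have -> : `]x, +oo[ = ~` `]-oo, x] by rewrite setCitvl.
  rewrite preimage_setC; transitivity (1 - mu `]-oo, x])%E.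
    by apply: probability_setC; exact: measurable_itv.
  transitivity (1 - unif (quantile_fun mu @^-1` `]-oo, x]))%E; last first.
    by apply/esym; exact: probability_setC.
  congr (1 - _)%E; rewrite -cdfE -(uniform_clamp_le (cdf_itv01 mu x)) -quantile_fun_le.
  by congr (unif _); apply/seteqP; split => u; rewrite /= in_itv.
- by move=> n; rewrite -ge0_fin_numE// fin_num_measure.
Qed.

End Quantile.

Section Coordinates.
Context d (T : measurableType d) (R : realType).
Implicit Types xs : seq (T -> R).

Lemma nth_comp_measurable xs (phi : R -> R) : measurable_fun setT phi ->
  (forall i, measurable_fun setT (nth (fun=> 0) xs i)) ->
  forall i, measurable_fun setT (nth (fun=> 0) [seq phi \o h | h <- xs] i).
Proof.
move=> mphi mx i; have [il|il] := ltnP i (size xs); last first.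
  by rewrite nth_default ?size_map//; exact: measurable_cst.
by rewrite (nth_map (fun=> 0))//; exact: measurableT_comp.
Qed.

Lemma nth_take_measurable xs a :
  (forall i, measurable_fun setT (nth (fun=> 0) xs i)) ->
  forall i, measurable_fun setT (nth (fun=> 0) (take a xs) i).
Proof.
move=> mx i; have [ia|ia] := ltnP i a; first by rewrite nth_take.
by rewrite nth_default ?size_take_min ?geq_min ?ia//; exact: measurable_cst.
Qed.

Lemma nth_drop_measurable xs a :
  (forall i, measurable_fun setT (nth (fun=> 0) xs i)) ->
  forall i, measurable_fun setT (nth (fun=> 0) (drop a xs) i).
Proof. by move=> mx i; rewrite nth_drop. Qed.

Lemma nth_cst_measurable (s : seq R) i :
  measurable_fun setT (nth (fun=> 0) [seq (fun=> y) | y <- s] i : T -> R).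
Proof.
have [il|il] := ltnP i (size s); last first.
  by rewrite nth_default ?size_map//; exact: measurable_cst.
by rewrite (nth_map 0)//; exact: measurable_cst.
Qed.

End Coordinates.

Lemma iid_expect_take (R : realType) (mu : probability R R) a b (f : seq R -> \bar R) :
  iid_expect mu (a + b) (fun s => f (take a s)) = iid_expect mu a f.
Proof.
rewrite iid_expect_cat; apply: iid_expect_ext => s sa.
rewrite -[RHS](iid_expect_cst mu b); apply: iid_expect_ext => t _.
by rewrite take_size_cat.
Qed.

Section QuantileCoupling.
Variable R : realType.
Variables (muB muS : probability R R) (g : seq R -> seq R -> R).
Hypothesis g_ge0 : forall bs ss, (0 <= (g bs ss)%:E)%E.
Hypothesis measurable_g : forall d (T : measurableType d) (xs ys : seq (T -> R)),
  (forall i, measurable_fun setT (nth (fun=> 0) xs i)) ->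
  (forall i, measurable_fun setT (nth (fun=> 0) ys i)) ->
  measurable_fun setT (fun w => (g [seq h w | h <- xs] [seq h w | h <- ys])%:E : \bar R).
Let beta := quantile_fun muB.
Let varsigma := quantile_fun muS.
Let P := uniform01 R.

Lemma seq_measurable_market k a b c :
  seq_measurable k (fun us => (g (map beta (take a us)) (map varsigma (take b (drop c us))))%:E).
Proof.
move=> d T xs _ mx.
have := @measurable_g _ _ [seq beta \o h | h <- take a xs]
  [seq varsigma \o h | h <- take b (drop c xs)].
move=> H; apply: eq_measurable_fun (H _ _) => [w _||].
- by rewrite -!map_drop -!map_take -!map_comp.
- by apply: nth_comp_measurable; [exact: measurable_quantile_fun|exact: nth_take_measurable].
- apply: nth_comp_measurable; first exact: measurable_quantile_fun.
  by apply: nth_take_measurable; exact: nth_drop_measurable.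
Qed.

Lemma expected_gft_quantile m n :
  expected_gft g muB muS m n = iid_expect P m (fun s => iid_expect P n (fun t =>
    (g (map beta s) (map varsigma t))%:E)).
Proof.
rewrite /expected_gft.
transitivity (iid_expect muB m (fun bs => iid_expect P n (fun t => (g bs (map varsigma t))%:E))).
  apply: iid_expect_ext => bs _.
  apply: (iid_expect_pushforward (measurable_quantile_fun muS)) => //.
    exact: quantile_fun_pushforward.
  move=> d T xs _ mx; have := @measurable_g _ T [seq (fun=> y) | y <- bs] xs.
  move=> H; apply: eq_measurable_fun (H _ _) => // [w _|]; last exact: nth_cst_measurable.
  by rewrite -map_comp map_id.
apply: (iid_expect_pushforward (measurable_quantile_fun muB)).
- exact: quantile_fun_pushforward.
- by move=> s; exact: iid_expect_ge0.
(* Joining both lists in one sequence lets [iid_expect_measurable] treat the inner expectation as a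
   function of the buyers' quantiles. *)
pose f s := (g (take m s) (map varsigma (drop m s)))%:E.
apply: (@seq_measurable_ext _ _ (fun s => iid_expect P n (fun t => f (s ++ t)))).
  by move=> s sm; apply: iid_expect_ext => t _; rewrite /f take_size_cat ?drop_size_cat.
apply: iid_expect_measurable => [s|d T xs _ mx]; first exact: g_ge0.
have := @measurable_g _ _ (take m xs) [seq varsigma \o h | h <- drop m xs].
move=> H; apply: eq_measurable_fun (H _ _) => [w _||].
- by rewrite /f -!map_drop -!map_take -!map_comp.
- exact: nth_take_measurable.
- apply: nth_comp_measurable; first exact: measurable_quantile_fun.
  exact: nth_drop_measurable.
Qed.

(** Pads the market with [a] buyers and [b] sellers whose quantiles are ignored. Padding by [4] puts
    the original market on the quantiles of the augmented one, which is itself the case of padding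
    by [0]. *)
Lemma expected_gft_market m n a b :
  expected_gft g muB muS m n = iid_expect P ((m + a) + (n + b))
    (fun us => (g (map beta (take m us)) (map varsigma (take n (drop (m + a) us))))%:E).
Proof.
rewrite expected_gft_quantile -(iid_expect_take _ m a) [RHS]iid_expect_cat.
apply: iid_expect_ext => s sma; rewrite -(iid_expect_take _ n b).
by apply: iid_expect_ext => t _; rewrite takel_cat ?sma ?leq_addr// drop_size_cat.
Qed.

End QuantileCoupling.

Lemma perm_seq_idx (R : realType) N (s : 'S_N) :
  perm_eq [seq val (s i) | i <- enum 'I_N] (iota 0 N).
Proof.
rewrite -val_enum_ord (map_comp val s); apply: perm_map.
apply: uniq_perm => [||i]; last 1 first.
  by rewrite mem_enum; apply/mapP; exists (s^-1 i)%g; rewrite ?mem_enum ?permKV.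
- by rewrite map_inj_uniq ?enum_uniq//; exact: perm_inj.
- exact: enum_uniq.
Qed.

(** * From the comparison at each price level to expectations *)

Section Main.
Local Open Scope ereal_scope.
Context (R : realType) (m n : nat) (muB muS : probability R R).
Hypothesis nm : (n <= m)%N.
Hypothesis BS : fosd muB muS.
Let N := ((m + 4) + (n + 4))%N.
Let beta := quantile_fun muB.
Let varsigma := quantile_fun muS.
Let P := uniform01 R.

Let Gopt us : \bar R := (opt_gft (map beta (take m us)) (map varsigma (take n (drop (m + 4) us))))%:E.
Let Gstr us : \bar R := (str_gft (map beta (take (m + 4) us)) (map varsigma (take (n + 4) (drop (m + 4) us))))%:E.

Let Gopt_ge0 us : 0 <= Gopt us. Proof. exact: opt_gft_ge0. Qed.
Let Gstr_ge0 us : 0 <= Gstr us. Proof. exact: str_gft_ge0. Qed.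

Let mGopt : seq_measurable N Gopt.
Proof.
by apply: seq_measurable_market => d T xs ys; exact: measurable_opt_gft.
Qed.

Let mGstr : seq_measurable N Gstr.
Proof.
by apply: seq_measurable_market => d T xs ys; exact: measurable_str_gft.
Qed.

(** Stochastic dominance enters here, at a clamped level inside []0, 1[]. *)
Let varsigma_beta u : (varsigma u <= beta u)%R.
Proof. by apply: BS; exact: unit_clamp_itv. Qed.

Let sum_Gopt_le_Gstr us : size us = N ->
  \sum_(s : 'S_N) Gopt (perm_seq 0%R s us) <= \sum_(s : 'S_N) Gstr (perm_seq 0%R s us).
Proof.
move=> sus.
under eq_bigr do rewrite /Gopt opt_gft_layers.
under [leRHS]eq_bigr do rewrite /Gstr str_gft_layers.
rewrite -!ge0_integral_sum//; first last.
- by move=> s; exact: measurable_opt_layer.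
- by move=> s; exact: measurable_str_layer.
apply: ge0_le_integral => //.
- by move=> x _; apply: sume_ge0 => s _; rewrite lee_fin.
- by apply: emeasurable_sum => s; exact: measurable_opt_layer.
- by apply: emeasurable_sum => s; exact: measurable_str_layer.
move=> x _; rewrite !sumEFin lee_fin -!natr_sum ler_nat.
pose r : rel R := fun u v => (unit_clamp v <= unit_clamp u)%R.
have r_trans : transitive r by move=> u v w vu uw; exact: le_trans uw vu.
have r_total : total r by move=> u v; exact: le_total.
have := @market_opt_le_str R beta varsigma r r_trans r_total _ varsigma_beta m n nm us x sus.
move=> /(_ (@quantile_fun_mono _ _)) /leq_trans; apply.
apply: leq_sum => s _; rewrite /market_str [take (n + 4) _]take_oversize//.
by rewrite size_drop size_perm_seq addKn.
Qed.

Let seq_measurable_perm (s : 'S_N) (G : seq R -> \bar R) : seq_measurable N G ->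
  seq_measurable N (fun us => G (perm_seq 0%R s us)).
Proof.
move=> mG d T xs sxs mx.
pose ys := [seq nth (fun=> 0%R) xs (s i) | i <- enum 'I_N].
have := mG _ T ys; rewrite size_map size_enum_ord => /(_ erefl) H.
apply: eq_measurable_fun (H _) => [w _|i].
  congr G; rewrite -map_comp; apply: eq_map => i /=.
  by rewrite (nth_map (fun=> 0%R))// sxs.
have [il|il] := ltnP i N; last first.
  rewrite nth_default; last by rewrite size_map size_enum_ord.
  exact: measurable_cst.
by rewrite (nth_map (Ordinal il)) ?size_enum_ord.
Qed.

(** Independent draws from one law are exchangeable, so each permuted copy of [G] has the same
    expectation. *)
Let perm_invariant (G : seq R -> \bar R) : (forall us, 0 <= G us) ->
  seq_measurable N G ->
  iid_expect P N (fun us => \sum_(s : 'S_N) G (perm_seq 0%R s us)) =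
  (#|{: 'S_N}|%:R)%:E * iid_expect P N G.
Proof.
move=> G0 mG; rewrite iid_expect_sum//; last by move=> s; exact: seq_measurable_perm.
under eq_bigr => s _.
  rewrite (_ : iid_expect P N _ = iid_expect P N G); first over.
  rewrite -(iid_expect_perm P G0 mG (perm_seq_idx R s)).
  by apply: iid_expect_ext => us _; rewrite -map_comp.
by rewrite mule_natl sumr_const.
Qed.

Lemma OPT_le_STR : OPT muB muS m n <= STR muB muS (m + 4) (n + 4).
Proof.
have -> : OPT muB muS m n = iid_expect P N Gopt.
  apply: expected_gft_market; first exact: opt_gft_ge0.
  by move=> d T xs ys; exact: measurable_opt_gft.
have -> : STR muB muS (m + 4) (n + 4) = iid_expect P N Gstr.
  rewrite /STR (@expected_gft_market _ _ _ _ _ _ (m + 4) (n + 4) 0 0) ?addn0//.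
  - exact: str_gft_ge0.
  - by move=> d T xs ys; exact: measurable_str_gft.
have c0 : 0 < (#|{: 'S_N}|%:R)%:E :> \bar R.
  by rewrite lte_fin ltr0n; apply/card_gt0P; exists 1%g.
(* Scaling by the number of permutations, positive and finite, turns each side into the expectation
   of a sum over permutations, where the comparison holds pointwise. *)
rewrite -(lee_pmul2l _ c0)// -!perm_invariant//.
apply: iid_expect_le.
- by move=> us; apply: sume_ge0.
- by move=> us; apply: sume_ge0.
- by apply: seq_measurable_sum => s; exact: seq_measurable_perm.
- by apply: seq_measurable_sum => s; exact: seq_measurable_perm.
- exact: sum_Gopt_le_Gstr.
Qed.

End Main.

Theorem theorem1p1 :
  exists c : nat, (0 < c)%N /\
    forall (R : realType) (m n : nat) (muB muS : probability R R),
      (1 <= n)%N -> (n <= m)%N -> fosd muB muS ->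
      (OPT muB muS m n <= STR muB muS (m + c) (n + c))%E.
Proof.
exists 4; split=> // R m n muB muS _ nm BS; exact: OPT_le_STR.
Qed.
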